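(* Let $\mathbf{G}$ be a finite group of exponent 2 and $w : \mathbb{N} \rightarrow \mathbb{R}$ be a growing function that tends to infinity. Let $A \subset \mathbf{G}$ be a random subset obtained by putting every element of $\mathbf{G}$ into $A$ independently with probability $\frac{1}{2}$. Then with probability $1 - o(1)$, for all sets $X, Y \subset \mathbf{G}$ such that $$|X|, |Y| \geq w(|\mathbf{G}|)(\log \log |\mathbf{G}|) \cdot \log^{3/2} |\mathbf{G}|,$$ one has $$\sum_{x \in X} \sum_{y \in Y} A(x+y) = \frac{1}{2}|X||Y| + o(|X||Y|) \quad (|\mathbf{G}| \rightarrow \infty),$$ where the rate of convergence implied by the $o$-notation depends only on $w$.
   Context: For a set $A \subset \mathbf{G}$, the same letter $A$ also denotes its characteristic function $A : \mathbf{G} \rightarrow \{0,1\}$, so $A(x+y)=1$ iff $x+y\in A$. A finite group of exponent 2 is abelian and is a vector space over $\mathbb{F}_2$. *)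

(* Defs.v *)
From HB Require Import structures.
From mathcomp Require Import all_boot all_order all_algebra all_fingroup all_solvable.
From mathcomp Require Import all_classical all_reals all_analysis.

Set Implicit Arguments.
Unset Strict Implicit.
Unset Printing Implicit Defensive.

Import Order.TTheory GRing.Theory Num.Theory.
Import numFieldNormedType.Exports.

Local Open Scope ring_scope.

(* Law of the random subset obtained by putting every element of T into it
   independently with probability p: the product over x of the Bernoulli(p)
   masses of the events "x is in S" / "x is not in S". *)
Definition random_subset_mass (R : realType) (T : finType) (p : R)
    (S : {set T}) : R :=
  \prod_(x : T) (if x \in S then p else 1 - p).

Definition random_subset_prob (R : realType) (T : finType) (p : R)
    (E : {set T} -> Prop) : R :=
  \sum_(S : {set T} | `[< E S >]) random_subset_mass p S.

Definition char_fun (R : realType) (T : finType) (S : {set T}) (x : T) : R :=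
  (x \in S)%:R.

(* The logarithms are natural; changing the base only changes the threshold by
   a bounded factor (for large n), which w absorbs. *)
Definition size_threshold (R : realType) (w : nat -> R) (n : nat) : R :=
  w n * ln (ln n%:R) * (ln n%:R `^ (3 / 2)).

(* Main.v *)
(* Write N = #|G| = 2 ^ d, replace the indicator of A by signs, and think of G as
   an F_2-space.  A union bound over all pairs (X, Y) of size about d ^ (3 / 2)
   is too expensive, so a pair with a biased sum is replaced by short random
   samples x_1, ..., x_s of X and y_1, ..., y_s of Y with s = O(d): they inherit
   the bias, and their additive energy is about
     s ^ 2 + s ^ 4 * E(X, Y) / (|X| |Y|) ^ 2,
   to which the subgaussian tail bound applies.  It remains to bound E(X, Y)
   or to count the samples more economically.
   Peel off from X linearly independent subsets of size m ~ sqrt d for as long as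
   possible.  By edge isoperimetry in the cube, an independent set L satisfies
   E(L, Y) = O(|L| |Y| log |Y|), so the union X1 of the peeled sets has energy
   O(|X1| ^ 2 |Y| log |Y| / m), small enough for the union bound over all
   N ^ (2 s) samples.  The rest of X spans a space of dimension less than m, and
   likewise for Y; samples of the two rests lie in a common subspace of dimension
   at most 2 m, so there are at most N ^ (2 m) * 2 ^ (4 m s) of them and the
   trivial bound on the energy suffices. *)
Require Import Defs.
From HB Require Import structures.
From mathcomp Require Import all_boot all_order all_algebra all_fingroup all_solvable.
From mathcomp Require Import all_classical all_reals all_analysis.
From mathcomp Require Import ring lra zify.

Set Implicit Arguments.
Unset Strict Implicit.
Unset Printing Implicit Defensive.

Import Order.TTheory GRing.Theory Num.Theory.
Import numFieldNormedType.Exports.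

Local Open Scope ring_scope.
(* Restores the finite-set lemmas shadowed by [classical_sets]. *)
Import mathcomp.boot.fintype mathcomp.boot.finset.

(** * Subgaussian tail bounds for random signs *)

(** The sharp exponent is [x ^+ 2 / 2]; the weaker constant 2 permits an elementary proof. For
    [x ^+ 2 > 1 / 2] one has [|x| <= 2 * x ^+ 2], so each exponential is bounded separately. *)
Lemma cosh_le (R : realType) (x : R) :
  expR x + expR (- x) <= 2 * expR (2 * x ^+ 2).
Proof.
have [xs|xl] := leP (x ^+ 2) (1 / 2); last first.
  have h : `|x| <= 2 * x ^+ 2.
    have : 1 / 2 <= `|x|.
      rewrite leNgt; apply/negP => xh; have : `|x| ^+ 2 <= (1 / 2) ^+ 2.
        by rewrite lerXn2r ?nnegrE// ltW.
      by rewrite real_normK ?num_real//; lra.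
    rewrite -(real_normK (num_real x)); have := normr_ge0 x; nra.
  have h1 : expR x <= expR (2 * x ^+ 2).
    by rewrite ler_expR (le_trans (ler_norm x)).
  have h2 : expR (- x) <= expR (2 * x ^+ 2).
    by rewrite ler_expR (le_trans _ h)// -normrN ler_norm.
  lra.
have e1 : 1 + x <= expR x by exact: expR_ge1Dx.
have e2 : 1 - x <= expR (- x) by exact: expR_ge1Dx.
have e3 : 1 + 2 * x ^+ 2 <= expR (2 * x ^+ 2) by exact: expR_ge1Dx.
have ee : expR x * expR (- x) = 1 by rewrite -expRD subrr expR0.
have xlt1 : 0 < 1 - x by nra.
have xgtm1 : 0 < 1 + x by nra.
have p1 : 0 < expR x by exact: expR_gt0.
have p2 : 0 < expR (- x) by exact: expR_gt0.
(* [expR x <= (1 - x)^-1] and [expR (- x) <= (1 + x)^-1] add up to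
   [2 / (1 - x ^+ 2) <= 2 * (1 + 2 * x ^+ 2)]. *)
have f1 : expR x * (1 - x) <= 1 by nra.
have f2 : expR (- x) * (1 + x) <= 1 by nra.
have g : (expR x + expR (- x)) * (1 - x ^+ 2) <= 2.
  have : expR x * (1 - x) * (1 + x) <= 1 + x by nra.
  have : expR (- x) * (1 + x) * (1 - x) <= 1 - x by nra.
  nra.
have h : 1 <= (1 + 2 * x ^+ 2) * (1 - x ^+ 2) by have := sqr_ge0 x; nra.
have : 0 < 1 - x ^+ 2 by lra.
have := sqr_ge0 x.
nra.
Qed.

Definition signed_char (R : realType) (T : finType) (A : {set T}) (z : T) : R :=
  if z \in A then 1 else - 1.

(** Chernoff's method in counting form: independence of the signs makes the exponential moment a
    product over [z], and [cosh_le] bounds each factor. The parameter [lam] stays free until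
    [deviation_union]. *)
Lemma random_sign_tail (R : realType) (T : finType) (c : T -> R) (lam tau : R) :
  0 <= lam ->
  #|[set A : {set T} | tau <= \sum_z c z * signed_char R A z]|%:R
  <= 2 ^+ #|T| * expR (2 * lam ^+ 2 * (\sum_z c z ^+ 2) - lam * tau).
Proof.
move=> lam0; set B := [set A | _].
have -> : #|B|%:R = \sum_(A in B) (1 : R) by rewrite sumr_const.
apply: (@le_trans _ _ (\sum_(A : {set T})
    expR (lam * (\sum_z c z * signed_char R A z) - lam * tau))).
  apply: (@le_trans _ _ (\sum_(A in B)
    expR (lam * (\sum_z c z * signed_char R A z) - lam * tau))).
    apply: ler_sum => A; rewrite inE => hA.
    by rewrite -(@expR0 R) ler_expR subr_ge0 ler_wpM2l.
  rewrite [leRHS](bigID (fun A => A \in B))/= lerDl.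
  by apply: sumr_ge0 => A _; exact: expR_ge0.
have -> : \sum_(A : {set T}) expR (lam * (\sum_z c z * signed_char R A z) - lam * tau) =
    expR (- (lam * tau)) * \prod_z (expR (lam * c z) + expR (- (lam * c z))).
  (* Expanding the product of two-term sums gives one summand per subset [A], with the first term
     taken at each [z] in [A]. *)
  rewrite bigA_distr mulr_sumr; apply: eq_bigr => A _.
  rewrite addrC expRD mulr_sumr; congr (_ * _).
  rewrite expR_sum; apply: eq_bigr => z _; rewrite /signed_char.
  by case: (z \in A); congr expR; ring.
rewrite [in leRHS]addrC expRD mulrCA ler_wpM2l ?expR_ge0//.
apply: (@le_trans _ _ (\prod_(z : T) (2 * expR (2 * (lam * c z) ^+ 2)))).
  apply: ler_prod => z _; rewrite addr_ge0 ?expR_ge0//=; exact: cosh_le.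
rewrite big_split/= prodr_const -expR_sum mulr_sumr.
rewrite ler_pM2l ?exprn_gt0//= ler_expR; apply: ler_sum => z _.
by rewrite exprMn mulrA.
Qed.

(** * Groups of exponent 2 as vector spaces over the field with two elements *)

Lemma exponent2_mulgg (G : finGroupType) (x : G) :
  exponent [set: G]%G = 2%N -> (x * x = 1)%g.
Proof. by move=> hG; rewrite -(expg_exponent (finset.in_setT x)) hG expgS expg1. Qed.

Lemma exponent2_mulgC (G : finGroupType) (x y : G) :
  exponent [set: G]%G = 2%N -> (x * y = y * x)%g.
Proof.
move=> hG; have ab : abelian [set: G].
  by apply: (@abelem_abelian _ 2); rewrite exponent2_abelem ?hG.
by apply: (centsP ab); rewrite inE.
Qed.

(* In vector space terms [W] is the kernel of a coordinate form of [l] relative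
   to the linearly independent set [L]. *)
Lemma dual_hyperplane (G : finGroupType) (L : {set G}) (l : G) :
  exponent [set: G]%G = 2%N -> l \notin <<L :\ l>>%g ->
  exists W : {set G}, (forall x, (x * l \in W)%g = (x \notin W)) /\
    (forall u, u \in L -> u != l -> forall x, (x * u \in W)%g = (x \in W)).
Proof.
move=> hG hl.
have [K /maxgroupP[lK maxK] sK] :=
  @maxgroup_exists _ (fun H : {group G} => l \notin H) <<L :\ l>>%G hl.
exists K; split => [x|u uL ul x]; last first.
  by apply: groupMr; rewrite (subsetP sK)// mem_gen// in_setD1 ul.
have [xK|xK] /= := boolP (x \in K); first by rewrite groupMl// (negbTE lK).
(* By maximality of [K], adjoining [x] captures [l]. As [x] is an involution, the enlarged group is
   the union of [K] and [K * x], and [l] must lie in the second coset. *)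
have lKx : l \in (K <*> <[x]>)%G.
  apply/negPn/negP => h; have := maxK _ h (joing_subl _ _) => e.
  by move: xK; rewrite -e (subsetP (joing_subr _ _)) ?cycle_id.
move: lKx; rewrite /= norm_joinEr; last first.
  apply: cents_norm; apply/centsP => a _ b _; exact: exponent2_mulgC.
case/mulsgP => k y kK /cycleP[i ->] lE.
have x2 : (x ^+ 2 = 1)%g by rewrite expgS expg1 exponent2_mulgg.
move: lE; rewrite -(expg_mod i x2) modn2; case: (odd i) => lE.
  by rewrite lE expg1 (exponent2_mulgC k)// mulgA exponent2_mulgg// mul1g.
by move: lK; rewrite lE mulg1 kK.
Qed.

(** * Edge isoperimetry and the energy of independent sets *)

(** The induction step of edge isoperimetry, with [a] and [b] the sizes of the two pieces: the
    logarithm gains at least 1 over the smaller piece. The coefficient 2 of the logarithmic terms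
    pays for truncation; with coefficient 1 the case [a = 1], [b = 2] fails. *)
Lemma trunc_log2_split (a b : nat) : (0 < a)%N -> (0 < b)%N ->
  (2 * a * trunc_log 2 a + 2 * b * trunc_log 2 b + 2 * minn a b
   <= 2 * (a + b) * trunc_log 2 (a + b))%N.
Proof.
wlog ab : a b / (a <= b)%N => [hw a0 b0|a0 b0].
  have [ab|/ltnW ba] := leqP a b; first by have := hw _ _ ab a0 b0; lia.
  by have := hw _ _ ba b0 a0; rewrite (addnC b a); lia.
rewrite (minn_idPl ab).
have h1 : ((trunc_log 2 a).+1 <= trunc_log 2 (a + b))%N.
  apply: trunc_log_max => //; rewrite expnS mul2n -addnn leq_add//.
    by rewrite trunc_logP.
  by rewrite (leq_trans _ ab)// trunc_logP.
have h2 : (trunc_log 2 b <= trunc_log 2 (a + b))%N.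
  by rewrite leq_trunc_log// leq_addl.
by nia.
Qed.

Section translates.
Variable G : finGroupType.
Implicit Types (A B S L Q : {set G}) (l x z : G).
Local Open Scope group_scope.
Local Open Scope nat_scope.

Definition edges l A B := #|[set x in A | (x * l)%g \in B]|.

Lemma edges_le_l l A B : edges l A B <= #|A|.
Proof. by apply/subset_leq_card/subsetP => x; rewrite inE => /andP[]. Qed.

Lemma edges_le_r l A B : edges l A B <= #|B|.
Proof.
rewrite /edges -(card_imset _ (mulIg l)); apply/subset_leq_card/subsetP => y.
by case/imsetP => x; rewrite inE => /andP[_ h] ->.
Qed.

Lemma edgesS l A B A' B' : A \subset A' -> B \subset B' ->
  edges l A B <= edges l A' B'.
Proof.
move=> sA sB; apply/subset_leq_card/subsetP => x; rewrite !inE.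
by case/andP => /(subsetP sA)-> /(subsetP sB)->.
Qed.

(** Induction on [#|S|]: a direction [l] with an edge inside [S] has a dual set [W] that cuts [S]
    into two nonempty pieces. Only edges in direction [l] cross the cut. The existence of [W] is the
    form in which linear independence of [L] enters. *)
Lemma edge_isoperimetry L S :
  (forall l, l \in L -> exists W : {set G},
    (forall x, ((x * l)%g \in W) = (x \notin W)) /\
    (forall u, u \in L -> u != l -> forall x, ((x * u)%g \in W) = (x \in W))) ->
  \sum_(l in L) edges l S S <= 2 * #|S| * trunc_log 2 #|S|.
Proof.
move=> dual; have [n] := ubnP #|S|; elim: n S => // n IH S; rewrite ltnS => Sn.
have [/existsP[l /andP[lL /existsP[x /andP[xS xlS]]]]|noedge] :=
  boolP [exists l in L, [exists x in S, (x * l)%g \in S]]; last first.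
  rewrite big1// => l lL; apply/eqP; rewrite cards_eq0; apply/set0Pn => -[x].
  rewrite inE => /andP[xS xlS]; move/negP: noedge; apply.
  by apply/existsP; exists l; rewrite lL; apply/existsP; exists x; rewrite xS.
have [W [Wl Wu]] := dual l lL.
have cS : #|S :&: W| + #|S :\: W| = #|S| by rewrite cardsID.
have [a0 b0] : 0 < #|S :&: W| /\ 0 < #|S :\: W|.
  split; rewrite card_gt0; apply/set0Pn; have [xW|xW] := boolP (x \in W).
  - by exists x; rewrite inE xS xW.
  - by exists (x * l)%g; rewrite inE xlS Wl.
  - by exists (x * l)%g; rewrite !inE xlS Wl xW.
  - by exists x; rewrite !inE xS xW.
(* A crossing edge is recorded from each of its ends, and the records of one kind inject into either
   piece. *)
have el : edges l S S <= 2 * minn #|S :&: W| #|S :\: W|.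
  apply: (@leq_trans (edges l (S :&: W) (S :\: W) +
                      edges l (S :\: W) (S :&: W))).
    rewrite /edges -(cardsID W); apply: eq_leq; congr (_ + _); apply: eq_card => y.
      by rewrite !inE Wl; case: (y \in W); rewrite ?(andbT, andbF, andFb).
    by rewrite !inE Wl; case: (y \in W); rewrite ?(andbT, andbF, andFb).
  by rewrite mul2n -addnn leq_add// leq_min ?edges_le_l ?edges_le_r.
have eu : \sum_(u in L | u != l) edges u S S =
    \sum_(u in L | u != l) edges u (S :&: W) (S :&: W) +
    \sum_(u in L | u != l) edges u (S :\: W) (S :\: W).
  rewrite -big_split/=; apply: eq_bigr => u /andP[uL ul].
  rewrite /edges -(cardsID W); congr (_ + _); apply: eq_card => y.
    by rewrite !inE (Wu u)//; case: (y \in W); rewrite ?(andbT, andbF, andFb).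
  by rewrite !inE (Wu u)//; case: (y \in W); rewrite ?(andbT, andbF, andFb).
have sub A : \sum_(u in L | u != l) edges u A A <= \sum_(u in L) edges u A A.
  by rewrite [leqRHS](bigD1 l)//= leq_addl.
rewrite (bigD1 l)//= eu.
have IH1 : \sum_(u in L) edges u (S :&: W) (S :&: W) <=
    2 * #|S :&: W| * trunc_log 2 #|S :&: W| by apply: IH; lia.
have IH2 : \sum_(u in L) edges u (S :\: W) (S :\: W) <=
    2 * #|S :\: W| * trunc_log 2 #|S :\: W| by apply: IH; lia.
have := trunc_log2_split a0 b0; rewrite cS.
move=> split; apply: leq_trans split.
rewrite addnC leq_add// leq_add//; first exact: leq_trans (sub _) IH1.
exact: leq_trans (sub _) IH2.
Qed.

Lemma sum_edges L Q (Z : {set G}) :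
  \sum_(z in Z) #|[set l in L | (z * l)%g \in Q]| = \sum_(l in L) edges l Z Q.
Proof.
transitivity (\sum_(z in Z) \sum_(l in L) ((z * l)%g \in Q)).
  apply: eq_bigr => z _; rewrite -sum1dep_card big_mkcondr/=.
  by apply: eq_bigr => l _; case: (_ \in Q).
rewrite exchange_big/=; apply: eq_bigr => l _.
rewrite /edges -sum1dep_card big_mkcondr/=.
by apply: eq_bigr => z _; case: (_ \in Q).
Qed.

(* Split according to whether [r z], the number of [l] with [z * l \in Q], exceeds
   [4 * e]: by edge isoperimetry the popular [z] carry at most [4 * e * #|Q|] of
   the total mass of [r]. *)
Lemma independent_energy (L Q : {set G}) (e : nat) :
  exponent [set: G]%G = 2 ->
  (forall l, l \in L -> l \notin <<L :\ l>>%g) ->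
  #|L|.+1 * #|Q| < 2 ^ e ->
  \sum_z #|[set l in L | (z * l)%g \in Q]| ^ 2 <= 8 * e * #|L| * #|Q|.
Proof.
move=> hG indep he; set r := fun z => #|[set l in L | (z * l)%g \in Q]|.
have rL z : r z <= #|L|.
  by apply/subset_leq_card/subsetP => x; rewrite inE => /andP[].
set Z := [set z | 4 * e < r z].
have sumr (B : {set G}) : \sum_(z in B) r z <= #|L| * #|Q|.
  rewrite sum_edges -sum_nat_const; apply: leq_sum => l _; exact: edges_le_r.
have ZT : \sum_(z in Z) (4 * e).+1 <= \sum_(z in Z) r z.
  by apply: leq_sum => z; rewrite inE.
rewrite sum_nat_const in ZT.
(* Enlarging both arguments to [Z :|: Q] gives edges inside a single set, as isoperimetry
   requires. *)
have TS : \sum_(z in Z) r z <= 2 * #|Z :|: Q| * trunc_log 2 #|Z :|: Q|.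
  rewrite sum_edges; apply: (@leq_trans (\sum_(l in L) edges l (Z :|: Q) (Z :|: Q))).
    by apply: leq_sum => l _; apply: edgesS; rewrite ?finset.subsetUl ?finset.subsetUr.
  apply: edge_isoperimetry => l lL; apply: dual_hyperplane => //; exact: indep.
have cS : #|Z :|: Q| <= #|Z| + #|Q| by rewrite -cardsUI leq_addr.
have Zle : #|Z| <= #|L| * #|Q|.
  by apply: leq_trans (sumr Z); apply: leq_trans ZT; rewrite leq_pmulr.
have loge : trunc_log 2 #|Z :|: Q| <= e.
  have [->|S0] := posnP #|Z :|: Q|; first by rewrite trunc_log0.
  rewrite -ltnS -(@ltn_exp2l 2)//; apply: leq_ltn_trans (trunc_logP _ _) _ => //.
  apply: leq_ltn_trans cS _; apply: (@leq_ltn_trans (#|L|.+1 * #|Q|)).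
    by rewrite mulSn addnC leq_add2l.
  by apply: ltn_trans he _; rewrite ltn_exp2l.
(* Since [4 * e * #|Z|] is at most the left-hand side, the share [2 * e * #|Z|] of the isoperimetric
   bound is at most half of it and is absorbed. *)
have T4 : \sum_(z in Z) r z <= 4 * e * #|Q|.
  have : \sum_(z in Z) r z <= 2 * (#|Z| + #|Q|) * e.
    by apply: leq_trans TS _; rewrite leq_mul// leq_mul2l.
  by nia.
rewrite (bigID (fun z => z \in Z))/=.
have A1 : \sum_(z in Z) r z ^ 2 <= #|L| * (4 * e * #|Q|).
  apply: (@leq_trans (#|L| * \sum_(z in Z) r z)); last by rewrite leq_mul2l T4 orbT.
  by rewrite big_distrr/=; apply: leq_sum => z _; rewrite expnS expn1 leq_mul2r rL orbT.
have A2 : \sum_(z | z \notin Z) r z ^ 2 <= 4 * e * (#|L| * #|Q|).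
  apply: (@leq_trans (4 * e * \sum_(z in ~: Z) r z)); last first.
    by rewrite leq_mul2l sumr orbT.
  rewrite big_distrr/= [leqRHS](eq_bigl (fun z => z \notin Z)); last by move=> z; rewrite inE.
  apply: leq_sum => z; rewrite inE -leqNgt => h.
  by rewrite expnS expn1 leq_mul2r h orbT.
apply: leq_trans (leq_add A1 A2) _.
by move: #|L| #|Q| => a b; apply: eq_leq; ring.
Qed.

End translates.

(** * Additive energy of indexed families *)

Section energy.
Variables (R : realType) (T : finType).

(** Indexed families instead of sets, so that the same notion serves for sets and for samples with
    repeated entries. *)
Definition rep (I J : finType) (A : {pred I}) (B : {pred J}) (v : I -> J -> T)
  (z : T) : R := \sum_(i in A) \sum_(j in B) (v i j == z)%:R.

Definition energy (I J : finType) (A : {pred I}) (B : {pred J})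
    (v : I -> J -> T) : R :=
  \sum_(i in A) \sum_(j in B) \sum_(i' in A) \sum_(j' in B)
    (v i j == v i' j')%:R.

Lemma sum_rep (I J : finType) (A : {pred I}) (B : {pred J}) (v : I -> J -> T)
    (h : T -> R) :
  \sum_z rep A B v z * h z = \sum_(i in A) \sum_(j in B) h (v i j).
Proof.
under eq_bigr do rewrite mulr_suml.
rewrite exchange_big/=; apply: eq_bigr => i _.
under eq_bigr do rewrite mulr_suml.
rewrite exchange_big/=; apply: eq_bigr => j _.
rewrite (bigD1 (v i j))//= eqxx mul1r big1 ?addr0// => z zv.
by rewrite eq_sym (negbTE zv) mul0r.
Qed.

(** Identifies the energy with the sum of squared coefficients in [random_sign_tail]. *)
Lemma sum_sqr_rep (I J : finType) (A : {pred I}) (B : {pred J})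
    (v : I -> J -> T) :
  \sum_z rep A B v z ^+ 2 = energy A B v.
Proof.
under eq_bigr do rewrite expr2.
rewrite sum_rep; apply: eq_bigr => i _; apply: eq_bigr => j _.
by apply: eq_bigr => i' _; apply: eq_bigr => j' _; rewrite eq_sym.
Qed.

End energy.

(** * Averaging and random samples *)

Lemma exists_ge_mean (R : realType) (I : finType) (A : {pred I}) (c : R)
    (f : I -> R) :
  (0 < #|A|)%N -> c * #|A|%:R <= \sum_(i in A) f i ->
  exists2 i, i \in A & c <= f i.
Proof.
move=> A0 h; apply: contrapT => hn.
have lt_c i : i \in A -> f i < c.
  by move=> iA; rewrite ltNge; apply/negP => ci; apply: hn; exists i.
have : \sum_(i in A) f i < \sum_(i in A) c.
  case/card_gt0P : A0 => i0 i0A.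
  rewrite (bigD1 i0)//= [ltRHS](bigD1 i0)//= ltr_leD ?lt_c//.
  by apply: ler_sum => i /andP[iA _]; exact/ltW/lt_c.
by rewrite sumr_const -mulr_natr ltNge h.
Qed.

Section marginals.
Variables (R : realType) (T : finType) (P : {set T}) (s : nat).

Let samples : {pred {ffun 'I_s -> T}} := ffun_on (mem P).

Lemma card_samples : #|samples| = (#|P| ^ s)%N.
Proof. by rewrite card_ffun_on card_ord. Qed.

(** One entry of a uniform sample is uniform on [P]. Denominators are cleared, so an empty [P] needs
    no exception. *)
Lemma marginal1 (h : T -> R) (i : 'I_s) :
  #|P|%:R * \sum_(x in samples) h (x i) = #|P|%:R ^+ s * \sum_(a in P) h a.
Proof.
have inner a : a \in P ->
    #|P|%:R * (\sum_(x in samples) (x i == a)%:R) = #|P|%:R ^+ s :> R.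
  (* The indicator of [x i = a] is a product over all coordinates, trivial away from [i], so its sum
     over samples factors. *)
  move=> aP; pose phi (l : 'I_s) (c : T) : R := if l == i then (c == a)%:R else 1.
  have -> : \sum_(x in samples) (x i == a)%:R =
      \prod_(l < s) \sum_(c in P) phi l c.
    rewrite bigA_distr_big; apply: eq_bigr => x _.
    rewrite (bigD1 i)//= {1}/phi eqxx big1 ?mulr1// => l li.
    by rewrite /phi (negbTE li).
  rewrite (bigD1 i)//= {1}/phi eqxx (bigD1 a)//= eqxx big1; last first.
    by move=> c /andP[_ /negbTE->].
  rewrite addr0 mul1r -[in RHS](card_ord s) -prodr_const [RHS](bigD1 i)//=.
  congr (_ * _); apply: eq_bigr => l li; rewrite /phi (negbTE li).
  by rewrite sumr_const.
transitivity (#|P|%:R * \sum_(a in P) \sum_(x in samples) h a * (x i == a)%:R).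
  congr (_ * _); rewrite exchange_big/=; apply: eq_bigr => x /ffun_onP xP.
  rewrite (bigD1 (x i)) ?xP//= eqxx mulr1 big1 ?addr0// => a /andP[_ ax].
  by rewrite eq_sym (negbTE ax) mulr0.
rewrite !mulr_sumr; apply: eq_bigr => a aP.
by rewrite -mulr_sumr mulrCA inner// mulrC.
Qed.

(** Pairwise independence: two different entries of a uniform sample are jointly uniform on pairs
    from [P]. *)
Lemma marginal2 (h : T -> T -> R) (i j : 'I_s) : i != j ->
  #|P|%:R ^+ 2 * \sum_(x in samples) h (x i) (x j) =
  #|P|%:R ^+ s * \sum_(a in P) \sum_(b in P) h a b.
Proof.
move=> ij; have inner a b : a \in P -> b \in P ->
    #|P|%:R ^+ 2 * (\sum_(x in samples) ((x i == a) && (x j == b))%:R)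
    = #|P|%:R ^+ s :> R.
  move=> aP bP; pose phi (l : 'I_s) (c : T) : R :=
    if l == i then (c == a)%:R else if l == j then (c == b)%:R else 1.
  have ji : (j == i) = false by rewrite eq_sym (negbTE ij).
  have -> : \sum_(x in samples) ((x i == a) && (x j == b))%:R =
      \prod_(l < s) \sum_(c in P) phi l c.
    rewrite bigA_distr_big; apply: eq_bigr => x _.
    rewrite (bigD1 i)//= {1}/phi eqxx (bigD1 j) ?ji//= {1}/phi ji eqxx.
    rewrite big1 ?mulr1 -?natrM ?mulnb// => l /andP[li lj].
    by rewrite /phi (negbTE li) (negbTE lj).
  rewrite (bigD1 i)//= {1}/phi eqxx (bigD1 a)//= eqxx big1; last first.
    by move=> c /andP[_ /negbTE->].
  rewrite (bigD1 j) ?ji//= {1}/phi ji eqxx (bigD1 b)//= eqxx big1; last first.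
    by move=> c /andP[_ /negbTE->].
  rewrite !addr0 !mul1r -[in RHS](card_ord s) -prodr_const [RHS](bigD1 i)//=.
  rewrite [X in _ = _ * X](bigD1 j) ?ji//= mulrA -expr2.
  congr (_ * _); apply: eq_bigr => l /andP[li lj].
  by rewrite /phi (negbTE li) (negbTE lj) sumr_const.
transitivity (#|P|%:R ^+ 2 * \sum_(a in P) \sum_(b in P) \sum_(x in samples)
    h a b * ((x i == a) && (x j == b))%:R).
  congr (_ * _).
  under [RHS]eq_bigr do rewrite exchange_big/=.
  rewrite exchange_big/=; apply: eq_bigr => x /ffun_onP xP.
  rewrite (bigD1 (x i)) ?xP//= (bigD1 (x j)) ?xP//= !eqxx mulr1.
  rewrite [X in _ = _ + X + _]big1 ?addr0; last first.
    by move=> b /andP[_ bx]; rewrite andTb eq_sym (negbTE bx) mulr0.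
  rewrite big1 ?addr0// => a /andP[_ ax]; rewrite big1// => b _.
  by rewrite eq_sym (negbTE ax) mulr0.
rewrite !mulr_sumr; apply: eq_bigr => a aP.
rewrite !mulr_sumr; apply: eq_bigr => b bP.
by rewrite -mulr_sumr mulrCA inner// mulrC.
Qed.

End marginals.

Section sampling.
Variables (R : realType) (G : finGroupType) (P Q : {set G}) (s : nat) (rho : R).
Hypotheses (P0 : (0 < #|P|)%N) (Q0 : (0 < #|Q|)%N) (rho0 : 0 <= rho).
Hypothesis energyPQ :
  energy R (mem P) (mem Q) (fun p q => p * q)%g
  <= rho * #|P|%:R ^+ 2 * #|Q|%:R ^+ 2.

Let a : R := #|P|%:R.
Let b : R := #|Q|%:R.
Let SP : {pred {ffun 'I_s -> G}} := ffun_on (mem P).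
Let SQ : {pred {ffun 'I_s -> G}} := ffun_on (mem Q).

Let a0 : 0 < a. Proof. by rewrite ltr0n. Qed.
Let b0 : 0 < b. Proof. by rewrite ltr0n. Qed.
Let a_ge0 : 0 <= a. Proof. exact: ltW. Qed.
Let b_ge0 : 0 <= b. Proof. exact: ltW. Qed.

(** The four terms match the four coincidence patterns of the indices. If only [i = i'], a collision
    means [y j = y j'], of probability [1 / b]; if only [j = j'], it has probability [1 / a]; if
    neither holds, it is governed by the normalised energy, at most [rho]. *)
Lemma sum_samples_collision (i j i' j' : 'I_s) :
  \sum_(x in SP) \sum_(y in SQ) (x i * y j == x i' * y j')%g%:R
  <= a ^+ s * b ^+ s * ((i == i')%:R * (j == j')%:R + (i == i')%:R / b
       + (j == j')%:R / a + rho) :> R.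
Proof.
have as0 : 0 < a ^+ s by rewrite exprn_gt0.
have bs0 : 0 < b ^+ s by rewrite exprn_gt0.
have as_ge0 := ltW as0; have bs_ge0 := ltW bs0.
have sumSP (c : R) : \sum_(x in SP) c = a ^+ s * c.
  by rewrite sumr_const card_samples -mulr_natl natrX.
have sumSQ (c : R) : \sum_(x in SQ) c = b ^+ s * c.
  by rewrite sumr_const card_samples -mulr_natl natrX.
have eqdiag (B : {set G}) : \sum_(c in B) \sum_(d in B) (c == d)%:R = #|B|%:R :> R.
  rewrite -sum1_card natr_sum; apply: eq_bigr => c cB.
  rewrite (bigD1 c)//= eqxx big1 ?addr0// => d /andP[_ /negbTE dc].
  by rewrite eq_sym dc.
have [<-|ii'] := eqVneq i i'; have [<-|jj'] := eqVneq j j'.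
- under eq_bigr do under eq_bigr do rewrite eqxx.
  rewrite sumSP sumSQ mulr1 !mul1r ler_peMr ?mulr_ge0//.
  by rewrite -!addrA lerDl !addr_ge0 ?invr_ge0.
- under eq_bigr do under eq_bigr do rewrite (inj_eq (mulgI _)).
  rewrite sumSP -mulrA ler_pM2l// !mul0r mulr0 add0r mul1r.
  have := marginal2 Q (fun c d : G => (c == d)%:R : R) jj'.
  rewrite eqdiag -/b -/SQ => h.
  have -> : \sum_(y in SQ) (y j == y j')%:R = b ^+ s * b^-1.
    apply: (@mulfI _ (b ^+ 2)); first by rewrite expf_neq0// gt_eqF.
    by rewrite h; field; rewrite gt_eqF.
  by rewrite ler_pM2l// addr0 lerDl.
- under eq_bigr do under eq_bigr do rewrite (inj_eq (mulIg _)).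
  under eq_bigr do rewrite sumSQ.
  rewrite -mulr_sumr !mul0r addr0 mul1r add0r.
  have := marginal2 P (fun c d : G => (c == d)%:R : R) ii'.
  rewrite eqdiag -/a -/SP => h.
  have -> : \sum_(x in SP) (x i == x i')%:R = a ^+ s * a^-1.
    apply: (@mulfI _ (a ^+ 2)); first by rewrite expf_neq0// gt_eqF.
    by rewrite h; field; rewrite gt_eqF.
  by rewrite mulrCA mulrA ler_pM2l ?mulr_gt0// lerDl.
- rewrite !mul0r !add0r.
  rewrite -(@ler_pM2l _ (a ^+ 2 * b ^+ 2)) ?mulr_gt0 ?exprn_gt0//.
  have -> : a ^+ 2 * b ^+ 2 * (\sum_(x in SP) \sum_(y in SQ)
      (x i * y j == x i' * y j')%g%:R) = a ^+ s * b ^+ s *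
      energy R (mem P) (mem Q) (fun p q => p * q)%g.
    rewrite [X in _ * X](_ : _ = \sum_(x in SP) (b ^- 2 * (b ^+ s *
        \sum_(q in Q) \sum_(q' in Q) (x i * q == x i' * q')%g%:R))).
      rewrite -mulr_sumr -mulr_sumr.
      have := marginal2 P (fun c d : G =>
        \sum_(q in Q) \sum_(q' in Q) (c * q == d * q')%g%:R : R) ii'.
      rewrite -/a -/SP.
      move: (\sum_(x in SP) _) => X hX.
      have -> : energy R (mem P) (mem Q) (fun p q => p * q)%g =
          \sum_(c in P) \sum_(d in P) \sum_(q in Q) \sum_(q' in Q)
            (c * q == d * q')%g%:R.
        apply: eq_bigr => c _; rewrite exchange_big/=; exact: eq_bigr.
      transitivity (b ^+ s * (a ^+ 2 * X)); first by field; rewrite gt_eqF.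
      by rewrite hX; ring.
    apply: eq_bigr => x _.
    have := marginal2 Q (fun q q' : G => (x i * q == x i' * q')%g%:R : R) jj'.
    by rewrite -/b -/SQ => <-; field; rewrite gt_eqF.
  have := energyPQ; rewrite -/a -/b => h.
  by rewrite [leRHS](_ : _ = a ^+ s * b ^+ s * (rho * a ^+ 2 * b ^+ 2));
    [rewrite ler_pM2l ?mulr_gt0|ring].
Qed.

Lemma sum_samples_energy :
  \sum_(x in SP) \sum_(y in SQ)
    energy R predT predT (fun i j : 'I_s => x i * y j)%g
  <= a ^+ s * b ^+ s * (s%:R ^+ 2 + s%:R ^+ 3 / b + s%:R ^+ 3 / a
       + s%:R ^+ 4 * rho).
Proof.
have -> : \sum_(x in SP) \sum_(y in SQ)
    energy R predT predT (fun i j : 'I_s => x i * y j)%g =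
    \sum_(i < s) \sum_(j < s) \sum_(i' < s) \sum_(j' < s)
    \sum_(x in SP) \sum_(y in SQ) (x i * y j == x i' * y j')%g%:R :> R.
  rewrite /energy; under eq_bigr do rewrite exchange_big/=.
  rewrite exchange_big/=; apply: eq_bigr => i _.
  under eq_bigr do rewrite exchange_big/=.
  rewrite exchange_big/=; apply: eq_bigr => j _.
  under eq_bigr do rewrite exchange_big/=.
  rewrite exchange_big/=; apply: eq_bigr => i' _.
  under eq_bigr do rewrite exchange_big/=.
  by rewrite exchange_big/=; apply: eq_bigr => j' _.
apply: (@le_trans _ _ (\sum_(i < s) \sum_(j < s) \sum_(i' < s) \sum_(j' < s)
   a ^+ s * b ^+ s * ((i == i')%:R * (j == j')%:R + (i == i')%:R / b
       + (j == j')%:R / a + rho))).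
  do 4 (apply: ler_sum => ? _).
  exact: sum_samples_collision.
have sum_diag (i : 'I_s) : \sum_(i' < s) (i == i')%:R = 1 :> R.
  rewrite (bigD1 i)//= eqxx big1 ?addr0// => k /negbTE ki.
  by rewrite eq_sym ki.
have sum_cst (c : R) : \sum_(i' < s) c = s%:R * c.
  by rewrite sumr_const card_ord mulr_natl.
rewrite [leLHS](_ : _ = \sum_(i < s) \sum_(j < s) a ^+ s * b ^+ s *
    (1 + s%:R / b + s%:R / a + s%:R ^+ 2 * rho)).
  rewrite !sum_cst -subr_ge0 [X in 0 <= X](_ : _ = 0)//.
  by field; rewrite !gt_eqF.
apply: eq_bigr => i _; apply: eq_bigr => j _.
rewrite [LHS](_ : _ = \sum_(i' < s) a ^+ s * b ^+ s * ((i == i')%:R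
    + s%:R * ((i == i')%:R / b) + a^-1 + s%:R * rho)).
  rewrite -mulr_sumr !big_split/= !sum_cst -mulr_sumr -mulr_suml sum_diag.
  by congr (_ * _); ring.
apply: eq_bigr => i' _; rewrite -mulr_sumr !big_split/= !sum_cst.
by rewrite -mulr_sumr -mulr_suml sum_diag !mulr1 mul1r.
Qed.

(** A single pair of samples must have both bias and low energy, so separate averages would not do;
    one weighted combination of the two is averaged. *)
Lemma exists_low_energy_samples (h : G -> R) (theta M : R) :
  (0 < s)%N -> 0 < theta -> (forall g, h g <= 1) ->
  theta * (a * b) <= \sum_(p in P) \sum_(q in Q) h (p * q)%g ->
  s%:R ^+ 2 + s%:R ^+ 3 / b + s%:R ^+ 3 / a + s%:R ^+ 4 * rho <= M ->
  exists x y : {ffun 'I_s -> G}, [/\ x \in SP, y \in SQ,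
    theta / 2 * s%:R ^+ 2 <= \sum_(i < s) \sum_(j < s) h (x i * y j)%g &
    energy R predT predT (fun i j : 'I_s => x i * y j)%g <= 2 / theta * M].
Proof.
move=> s0 th0 h1 hPQ hM.
pose F (x y : {ffun 'I_s -> G}) := \sum_(i < s) \sum_(j < s) h (x i * y j)%g.
pose E (x y : {ffun 'I_s -> G}) :=
  energy R predT predT (fun i j : 'I_s => x i * y j)%g.
have s0' : 0 < s%:R :> R by rewrite ltr0n.
have M0 : 0 < M.
  apply: lt_le_trans hM; rewrite -!addrA ltr_pwDl ?exprn_gt0//.
  by rewrite !addr_ge0 ?mulr_ge0 ?invr_ge0 ?exprn_ge0 ?(ltW s0').
have E0 x y : 0 <= E x y by do 4 (apply: sumr_ge0 => ? _).
have meanF : \sum_(x in SP) \sum_(y in SQ) F x y >=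
    a ^+ s * b ^+ s * (s%:R ^+ 2 * theta).
  have -> : \sum_(x in SP) \sum_(y in SQ) F x y =
      \sum_(i < s) \sum_(j < s) \sum_(x in SP) \sum_(y in SQ) h (x i * y j)%g.
    under eq_bigr do rewrite exchange_big/=.
    rewrite exchange_big/=; apply: eq_bigr => i _.
    under eq_bigr do rewrite exchange_big/=.
    by rewrite exchange_big/=.
  have term (i j : 'I_s) : a ^+ s * b ^+ s * theta <=
      \sum_(x in SP) \sum_(y in SQ) h (x i * y j)%g.
    rewrite -(@ler_pM2l _ (a * b)) ?mulr_gt0//.
    have -> : a * b * (\sum_(x in SP) \sum_(y in SQ) h (x i * y j)%g) =
        a ^+ s * b ^+ s * \sum_(p in P) \sum_(q in Q) h (p * q)%g.
      rewrite [X in _ * X](_ : _ = \sum_(x in SP) (b^-1 * (b ^+ s *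
          \sum_(q in Q) h (x i * q)%g))).
        rewrite -mulr_sumr -mulr_sumr.
        have := marginal1 P (fun c : G => \sum_(q in Q) h (c * q)%g) i.
        rewrite -/a -/SP; move: (\sum_(x in SP) _) => X hX.
        transitivity (b ^+ s * (a * X)); first by field; rewrite gt_eqF.
        by rewrite hX; ring.
      apply: eq_bigr => x _.
      have := marginal1 Q (fun q : G => h (x i * q)%g) j.
      by rewrite -/b -/SQ => <-; field; rewrite gt_eqF.
    rewrite [leLHS](_ : _ = a ^+ s * b ^+ s * (theta * (a * b))); last by ring.
    by rewrite ler_pM2l ?mulr_gt0 ?exprn_gt0.
  apply: (@le_trans _ _ (\sum_(i < s) \sum_(j < s) a ^+ s * b ^+ s * theta)).
    have sum_cst (c : R) : \sum_(i' < s) c = s%:R * c.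
      by rewrite sumr_const card_ord mulr_natl.
    rewrite !sum_cst -subr_ge0.
    by rewrite [X in 0 <= X](_ : _ = 0)//; ring.
  by apply: ler_sum => i _; apply: ler_sum => j _; exact: term.
have meanE := sum_samples_energy.
(* Averaging [M * F - theta / 2 * s ^ 2 * E] controls bias and energy at once. *)
have key : M * (s%:R ^+ 2 * theta) / 2 * #|SQ|%:R * #|SP|%:R <=
    \sum_(x in SP) \sum_(y in SQ) (M * F x y - theta / 2 * s%:R ^+ 2 * E x y).
  rewrite !card_samples !natrX -/a -/b.
  have -> : \sum_(x in SP) \sum_(y in SQ)
      (M * F x y - theta / 2 * s%:R ^+ 2 * E x y) =
      M * (\sum_(x in SP) \sum_(y in SQ) F x y) -
      theta / 2 * s%:R ^+ 2 * \sum_(x in SP) \sum_(y in SQ) E x y.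
    rewrite !mulr_sumr -sumrB; apply: eq_bigr => x _.
    by rewrite !mulr_sumr -sumrB.
  set W := a ^+ s * b ^+ s in meanF meanE.
  have W0 : 0 < W by rewrite mulr_gt0 ?exprn_gt0.
  have e1 : M * (W * (s%:R ^+ 2 * theta)) <=
      M * (\sum_(x in SP) \sum_(y in SQ) F x y) by rewrite ler_pM2l.
  have e2 : \sum_(x in SP) \sum_(y in SQ) E x y <= W * M.
    by apply: le_trans meanE _; rewrite ler_pM2l.
  have e3 : theta / 2 * s%:R ^+ 2 * (\sum_(x in SP) \sum_(y in SQ) E x y) <=
      theta / 2 * s%:R ^+ 2 * (W * M).
    by rewrite ler_pM2l// mulr_gt0 ?divr_gt0 ?exprn_gt0.
  apply: le_trans (lerB e1 e3).
  by rewrite -subr_ge0 /W [X in 0 <= X](_ : _ = 0)//; field.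
have [] := exists_ge_mean _ key.
  by rewrite card_samples expn_gt0 P0.
move=> x xP; rewrite -/SQ => hx.
have [|y yQ hy] := exists_ge_mean _ hx; first by rewrite card_samples expn_gt0 Q0.
exists x, y; split => //.
- rewrite -/(F x y) -(ler_pM2l M0).
  have : 0 <= theta / 2 * s%:R ^+ 2 * E x y.
    by rewrite !mulr_ge0 ?invr_ge0 ?exprn_ge0 ?(ltW M0) ?(ltW th0).
  by move: hy; move: (F x y) (E x y) => f e; lra.
(* As [h <= 1], the bias is at most [s ^ 2], so a nonnegative combination also caps the energy. *)
- have Fle : F x y <= s%:R ^+ 2.
    apply: (@le_trans _ _ (\sum_(i < s) \sum_(j < s) 1)).
      by apply: ler_sum => i _; apply: ler_sum.
    by rewrite !sumr_const card_ord -mulrnA -natrX expnS expn1.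
  rewrite -/(E x y) -(@ler_pM2l _ (theta / 2 * s%:R ^+ 2)); last first.
    by rewrite mulr_gt0 ?divr_gt0 ?exprn_gt0.
  rewrite [leRHS](_ : _ = M * s%:R ^+ 2); last by field; rewrite gt_eqF.
  have : M * F x y <= M * s%:R ^+ 2 by rewrite ler_pM2l.
  have : 0 <= M * (s%:R ^+ 2 * theta) / 2.
    by rewrite !mulr_ge0 ?invr_ge0 ?exprn_ge0 ?(ltW M0) ?(ltW th0).
  by move: hy; move: (F x y) (E x y) => f e; lra.
Qed.

End sampling.

(** * Energy bounds and the peeling decomposition *)

(** Deleting an element of at most average value does not lower the average; this is repeated until
    [k] elements remain. *)
Lemma subset_mean (R : realType) (T : finType) (g : T -> R) (X : {set T})
    (k : nat) : (0 < k)%N -> (k <= #|X|)%N ->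
  exists2 X' : {set T}, X' \subset X & #|X'| = k /\
    k%:R * (\sum_(x in X) g x) <= #|X|%:R * \sum_(x in X') g x.
Proof.
move=> k0 kX; have [n nX] : exists n, #|X| = (n + k)%N.
  by exists (#|X| - k)%N; rewrite subnK.
elim: n X {kX} nX => [|n IH] X nX; first by exists X; rewrite ?nX.
have X0 : 0 < #|X|%:R :> R by rewrite ltr0n nX.
have [||x xX hx] := @exists_ge_mean R _ (mem X)
  (- ((\sum_(y in X) g y) / #|X|%:R)) (fun y => - g y).
- by rewrite nX.
- by rewrite sumrN mulNr divfK// gt_eqF.
have [|X' sX' [cX' hX']] := IH (X :\ x).
  by move: nX; rewrite (cardsD1 x) xX add1n addSn => -[].
exists X'; first by apply: fintype.subset_trans sX' _; exact: subD1set.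
split=> //; have cXx : #|X :\ x| = (n + k)%N.
  by move: nX; rewrite (cardsD1 x) xX add1n addSn => -[].
have Xx0 : 0 < #|X :\ x|%:R :> R by rewrite ltr0n cXx addn_gt0 k0 orbT.
have eX : #|X|%:R = #|X :\ x|%:R + 1 :> R by rewrite (cardsD1 x) xX addrC natrD.
have sX : \sum_(y in X) g y = g x + \sum_(y in X :\ x) g y by exact: big_setD1.
have gx : #|X|%:R * g x <= \sum_(y in X) g y.
  by rewrite -ler_pdivlMl// mulrC -lerN2.
rewrite -(ler_pM2l Xx0); apply: (@le_trans _ _
    (k%:R * (#|X|%:R * \sum_(y in X :\ x) g y))).
  rewrite mulrCA ler_pM2l ?ltr0n//.
  move: gx; rewrite sX eX; move: (\sum_(y in X :\ x) g y) (g x) => u v; lra.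
rewrite mulrCA [leRHS]mulrCA ler_pM2l//.
Qed.

Section energy_bounds.
Variables (R : realType) (G : finGroupType).
Hypothesis hG : exponent [set: G]%G = 2%N.
Implicit Types (P Q X L : {set G}).

Notation mulenergy P Q := (energy R (mem P) (mem Q) (fun p q => p * q)%g).
Notation mulrep P Q := (rep R (mem P) (mem Q) (fun p q => p * q)%g).

(** As [p] is an involution, [p * q = z] means [q = z * p]; this matches the count in
    [independent_energy]. *)
Lemma mulrepE P Q z : mulrep P Q z = #|[set p in P | (z * p)%g \in Q]|%:R.
Proof.
rewrite -sum1dep_card natr_sum big_mkcondr/=; apply: eq_bigr => p pP.
have eqz q : (p * q == z)%g = (q == z * p)%g.
  rewrite -(inj_eq (mulgI p)) mulgA exponent2_mulgg// mul1g.
  by rewrite (exponent2_mulgC p z).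
under eq_bigr do rewrite eqz.
case: ifP => zpQ.
  rewrite (bigD1 (z * p)%g)//= eqxx big1 ?addr0// => q /andP[_ /negbTE->//].
by rewrite big1// => q qQ; case: eqP => // e; move: zpQ; rewrite -e qQ.
Qed.

(** Once [p], [q] and [p'] are chosen, [q'] is determined. *)
Lemma energy_le_trivial P Q :
  mulenergy P Q <= #|P|%:R ^+ 2 * #|Q|%:R.
Proof.
apply: (@le_trans _ _ (\sum_(p in P) \sum_(q in Q) \sum_(p' in P) 1)).
  apply: ler_sum => p _; apply: ler_sum => q _; apply: ler_sum => p' _.
  have eqq q' : (p * q == p' * q')%g = (q' == p'^-1 * (p * q))%g.
    by rewrite -(inj_eq (mulgI p'^-1%g)) mulKg eq_sym.
  under eq_bigr do rewrite eqq.
  have [qQ|qQ] := boolP ((p'^-1 * (p * q))%g \in Q).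
    by rewrite (bigD1 _ qQ)/= eqxx big1 ?addr0// => q' /andP[_ /negbTE->].
  by rewrite big1// => q' q'Q; case: eqP => // e; move: qQ; rewrite -e q'Q.
by rewrite !sumr_const -!mulrnA -natrX -natrM ler_nat expnS expn1; lia.
Qed.

(** The square root of the energy is the Euclidean norm of [rep], which is additive over disjoint
    unions in its first set. By the triangle inequality the constant [c] survives any number of
    unions. *)
Lemma energyU P1 P2 Q (c : R) : [disjoint P1 & P2] ->
  mulenergy P1 Q <= c * #|P1|%:R ^+ 2 -> mulenergy P2 Q <= c * #|P2|%:R ^+ 2 ->
  mulenergy (P1 :|: P2) Q <= c * #|P1 :|: P2|%:R ^+ 2.
Proof.
move=> dis; rewrite -!sum_sqr_rep => h1 h2.
have repU z : mulrep (P1 :|: P2) Q z = mulrep P1 Q z + mulrep P2 Q z.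
  by rewrite /rep -bigU//; apply: eq_bigl => p; rewrite !inE.
have [P10|P10] := posnP #|P1|; first by rewrite (cards0_eq P10) set0U.
have [P20|P20] := posnP #|P2|; first by rewrite (cards0_eq P20) setU0.
have cU : #|P1 :|: P2|%:R = #|P1|%:R + #|P2|%:R :> R.
  by rewrite -natrD -cardsUI disjoint_setI0// cards0 addn0.
have p10 : 0 < #|P1|%:R :> R by rewrite ltr0n.
have p20 : 0 < #|P2|%:R :> R by rewrite ltr0n.
rewrite cU; set a : R := #|P1|%:R in h1 p10 *; set b : R := #|P2|%:R in h2 p20 *.
(* [2 a b u v <= b^2 u^2 + a^2 v^2] *)
have pt z : a * b * mulrep (P1 :|: P2) Q z ^+ 2 <=
    (a + b) * (b * mulrep P1 Q z ^+ 2 + a * mulrep P2 Q z ^+ 2).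
  rewrite repU; set u := mulrep P1 Q z; set v := mulrep P2 Q z.
  rewrite -subr_ge0 [X in 0 <= X](_ : _ = (b * u - a * v) ^+ 2); last by ring.
  exact: sqr_ge0.
rewrite -(@ler_pM2l _ (a * b)) ?mulr_gt0//.
apply: (@le_trans _ _ ((a + b) * (b * (c * a ^+ 2) + a * (c * b ^+ 2)))).
  apply: (@le_trans _ _ ((a + b) * (b * (\sum_z mulrep P1 Q z ^+ 2) +
      a * (\sum_z mulrep P2 Q z ^+ 2)))).
    rewrite !(mulr_sumr, =^~ big_split)/=; apply: ler_sum => z _; exact: pt.
  by rewrite ler_pM2l ?addr_gt0// lerD// ler_pM2l.
by rewrite -subr_ge0 [X in 0 <= X](_ : _ = 0)//; ring.
Qed.

(** Each peeled set has exactly [m] elements, so [independent_energy] bounds its energy by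
    [8 * e * m * #|Q|], which is [8 * e / m] times [m ^ 2 * #|Q|]. The set [X1] is chosen before [Q]
    and [e]. *)
Lemma decomposition X (m : nat) : (0 < m)%N ->
  exists2 X1 : {set G}, X1 \subset X &
    (forall Q e, (m.+1 * #|Q| < 2 ^ e)%N ->
      mulenergy X1 Q <= (8 * e)%:R / m%:R * #|X1|%:R ^+ 2 * #|Q|%:R) /\
    (exists2 L : {set G}, (#|L| < m)%N & X :\: X1 \subset <<L>>%g).
Proof.
move=> m0; have [n] := ubnP #|X|; elim: n X => // n IH X Xn.
(* A minimal generating subset is independent. *)
have [L /minsetP[XL minL] LX] :=
  @minset_exists _ (fun L : {set G} => X \subset <<L>>%g) X (subset_gen X).
have [Lm|mL] := ltnP #|L| m.
  exists set0; first exact: sub0set.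
  split; last by exists L; rewrite ?setD0.
  by move=> Q e _; rewrite /energy big_set0 cards0 expr0n/= mulr0 mul0r.
have indep l : l \in L -> l \notin <<L :\ l>>%g.
  move=> lL; apply/negP => hl; have := minL (L :\ l).
  have -> : X \subset <<L :\ l>>%g.
    apply: fintype.subset_trans XL _; rewrite gen_subG; apply/fintype.subsetP => u uL.
    have [->//|ul] := eqVneq u l; by rewrite mem_gen// !inE ul.
  rewrite subD1set => /(_ isT isT) e; by move: lL; rewrite -e !inE eqxx.
(* The zero function reduces averaging to the choice of a subset of size [m]. *)
have [L' sL' [cL' _]] := subset_mean (fun _ : G => 0 : R) m0 mL.
have L'X := fintype.subset_trans sL' LX.
have [|X1 sX1 [hX1 [K Km hK]]] := IH (X :\: L').
  by move: Xn; rewrite -(cardsID L' X) (setIidPr L'X) cL'; lia.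
exists (X1 :|: L'); first by rewrite subUset L'X andbT (fintype.subset_trans sX1)// subsetDl.
split; last by exists K; rewrite // setUC -setDDl.
move=> Q e he; rewrite mulrAC; apply: energyU.
- rewrite disjoint_subset; apply/fintype.subsetP => u /(fintype.subsetP sX1).
  by rewrite !inE => /andP[].
- by rewrite mulrAC; exact: hX1.
- have indep' l : l \in L' -> l \notin <<L' :\ l>>%g.
    move=> lL'; apply: contra (indep l (fintype.subsetP sL' _ lL')).
    by apply/fintype.subsetP; apply: genS; exact: setSD.
  have := @independent_energy _ L' Q e hG indep'; rewrite cL' => /(_ he).
  rewrite -(ler_nat R) natr_sum => h.
  rewrite -sum_sqr_rep; under eq_bigr do rewrite mulrepE -natrX.
  apply: le_trans h _; rewrite 2!natrM -subr_ge0 [X in 0 <= X](_ : _ = 0)//.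
  by field; rewrite pnatr_eq0 -lt0n.
Qed.

Lemma card_gen_le L : (#|<<L>>%g| <= 2 ^ #|L|)%N.
Proof.
have ab : (2.-abelem <<L>>)%g.
  by apply: (abelemS (finset.subsetT _)); rewrite exponent2_abelem// hG.
rewrite (card_pgroup (abelem_pgroup ab)) leq_exp2l// -(rank_abelem ab).
by rewrite -(grank_abelian (abelem_abelian ab)) grank_min.
Qed.

End energy_bounds.

(** * Union bounds over samples *)

Lemma card_exists_le (U V : finType) (D : {set U}) (F : U -> {pred V}) :
  (#|[set v | [exists d in D, F d v]]| <= \sum_(d in D) #|[set v | F d v]|)%N.
Proof.
have -> : (\sum_(d in D) #|[set v | F d v]| = \sum_v #|[set d in D | F d v]|)%N.
  under eq_bigr do rewrite -sum1dep_card big_mkcond.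
  rewrite exchange_big; apply: eq_bigr => v _.
  by rewrite -sum1dep_card [RHS]big_mkcondr.
rewrite -sum1dep_card big_mkcond; apply: leq_sum => v _.
by case: existsP => // -[d dF]; rewrite card_gt0; apply/set0Pn; exists d; rewrite inE.
Qed.

Section spanned_samples.
Variables (R : realType) (G : finGroupType) (s : nat).
Hypothesis hG : exponent [set: G]%G = 2%N.

Notation samples := {ffun 'I_s -> G}.

Definition spanned (M : nat) : {set samples * samples} :=
  [set xy : samples * samples | [exists g in [set: {ffun 'I_M -> G}],
    [forall i, (xy.1 i \in <<g @: 'I_M>>%g) && (xy.2 i \in <<g @: 'I_M>>%g)]]].

(** The generators form a tuple, with [#|G| ^ M] choices; a subgroup of order at most [2 ^ M] then
    leaves at most [2 ^ M] values for each of the [2 * s] entries. *)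
Lemma card_spanned M : (#|spanned M| <= #|G| ^ M * 2 ^ (2 * M * s))%N.
Proof.
apply: leq_trans (card_exists_le _ _) _.
apply: (@leq_trans (\sum_(g in [set: {ffun 'I_M -> G}]) 2 ^ (2 * M * s))%N).
  apply: leq_sum => g _; set H := <<_>>%g.
  have cH : (#|H| <= 2 ^ M)%N.
    apply: leq_trans (card_gen_le hG _) _; rewrite leq_exp2l//.
    by apply: leq_trans (leq_imset_card _ _) _; rewrite card_ord.
  apply: (@leq_trans #|[predX (ffun_on (mem H) : {pred samples}) &
      (ffun_on (mem H) : {pred samples})]|).
    apply/subset_leq_card/subsetP => xy; rewrite !inE => /forallP h.
    by apply/andP; split; apply/ffun_onP => i; have /andP[] := h i.
  rewrite cardX !card_ffun_on !card_ord -expnD addnn -mul2n.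
  rewrite (_ : 2 * M * s = M * (2 * s))%N; last by ring.
  have [->|s0] := posnP (2 * s)%N; first by rewrite muln0.
  rewrite [X in (_ <= X)%N]expnM leq_exp2r//.
by rewrite sum_nat_const cardsT card_ffun card_ord.
Qed.

(** The constant [c] is a sign, so that deviations in both directions are covered. *)
Lemma deviation_union (D : {set samples * samples}) (c tau E : R) :
  c ^+ 2 = 1 -> 0 < E -> 0 < tau ->
  #|[set A : {set G} | [exists xy : samples * samples in D,
     (energy R predT predT (fun i j : 'I_s => xy.1 i * xy.2 j)%g <= E) &&
     (tau <= \sum_(i < s) \sum_(j < s) c * signed_char R A (xy.1 i * xy.2 j)%g)]]|%:R
  <= #|D|%:R * (2 ^+ #|G| * expR (- (tau ^+ 2 / (8 * E)))).
Proof.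
move=> c2 E0 tau0; pose F (xy : samples * samples) := [pred A : {set G} |
  (energy R predT predT (fun i j : 'I_s => xy.1 i * xy.2 j)%g <= E) &&
  (tau <= \sum_(i < s) \sum_(j < s) c * signed_char R A (xy.1 i * xy.2 j)%g)].
have := card_exists_le D F; rewrite -(ler_nat R) => /le_trans; apply.
rewrite natr_sum mulr_natl -sumr_const; apply: ler_sum => xy _.
pose v (i j : 'I_s) := (xy.1 i * xy.2 j)%g.
(* The minimiser of [2 * lam ^+ 2 * E - lam * tau], with minimum [- (tau ^+ 2 / (8 * E))]. *)
pose lam := tau / (4 * E).
have lam0 : 0 <= lam by rewrite divr_ge0// ?mulr_ge0// ltW.
(* The energy condition does not involve [A]; if it fails, the pair contributes nothing. *)
have [hE|hE] := leP (energy R predT predT v) E; last first.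
  rewrite (_ : [set A | _] = set0) ?cards0 ?mulr_ge0 ?exprn_ge0 ?expR_ge0//.
  by apply/setP => A; rewrite !inE leNgt hE.
have := @random_sign_tail R _ (fun z => c * rep R predT predT v z) lam tau lam0.
rewrite (_ : [set A | _] = [set A | F xy A]); last first.
  apply/setP => A; rewrite !inE hE/=; congr (_ <= _).
  rewrite -(sum_rep predT predT v (fun z => c * signed_char R A z)).
  by apply: eq_bigr => z _; ring.
move=> /le_trans; apply; rewrite ler_pM2l ?exprn_gt0// ler_expR.
under eq_bigr do rewrite exprMn c2 mul1r.
rewrite sum_sqr_rep; apply: (@le_trans _ _ (2 * lam ^+ 2 * E - lam * tau)).
  by rewrite lerB// ler_wpM2l// mulr_ge0// sqr_ge0.
rewrite -subr_ge0 [X in 0 <= X](_ : _ = 0)// /lam.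
by field; rewrite gt_eqF.
Qed.

End spanned_samples.

(** * Extraction of biased samples of low energy *)

Section structured_samples.
Variables (R : realType) (G : finGroupType) (h : G -> R) (theta : R) (k s : nat).
Hypotheses (h1 : forall g, h g <= 1) (theta0 : 0 < theta).
Hypotheses (k0 : (0 < k)%N) (s0 : (0 < s)%N) (sk : s%:R <= theta * k%:R).

(** Since [h <= 1], the large sum forces both sets to have at least [theta * k] elements. So
    [s <= theta * k] makes both cubic terms of the sample energy at most [s ^ 2], which gives the
    3. *)
Lemma dense_part_samples (P Q : {set G}) (kappa : R) : 0 <= kappa ->
  (#|P| <= k)%N -> (#|Q| <= k)%N ->
  theta * k%:R ^+ 2 <= \sum_(p in P) \sum_(q in Q) h (p * q)%g ->
  energy R (mem P) (mem Q) (fun p q => p * q)%g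
    <= kappa * #|P|%:R ^+ 2 * #|Q|%:R ->
  exists x y : {ffun 'I_s -> G}, [/\ forall i, x i \in P, forall i, y i \in Q,
    theta / 2 * s%:R ^+ 2 <= \sum_(i < s) \sum_(j < s) h (x i * y j)%g &
    energy R predT predT (fun i j : 'I_s => x i * y j)%g
    <= 2 / theta * (3 * s%:R ^+ 2 + s%:R ^+ 4 * (kappa / (theta * k%:R)))].
Proof.
move=> kap0 Pk Qk hPQ enPQ.
have kR : 0 < k%:R :> R by rewrite ltr0n.
have sR : 0 < s%:R :> R by rewrite ltr0n.
have PkR : #|P|%:R <= k%:R :> R by rewrite ler_nat.
have QkR : #|Q|%:R <= k%:R :> R by rewrite ler_nat.
have PQ : theta * k%:R ^+ 2 <= #|P|%:R * #|Q|%:R.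
  apply: le_trans hPQ _; apply: (@le_trans _ _ (\sum_(p in P) \sum_(q in Q) 1)).
    by apply: ler_sum => p _; apply: ler_sum.
  by rewrite !sumr_const -mulrnA natrM mulrC.
have thk : 0 < theta * k%:R by rewrite mulr_gt0.
have tP : theta * k%:R <= #|P|%:R.
  rewrite -(ler_pM2r kR) -mulrA -expr2; apply: le_trans PQ _.
  by rewrite ler_wpM2l.
have tQ : theta * k%:R <= #|Q|%:R.
  rewrite -(ler_pM2r kR) -mulrA -expr2; apply: le_trans PQ _.
  by rewrite mulrC ler_wpM2l.
have Pp : 0 < #|P|%:R :> R by exact: lt_le_trans tP.
have Qp : 0 < #|Q|%:R :> R by exact: lt_le_trans tQ.
have rho0 : 0 <= kappa / (theta * k%:R) by rewrite divr_ge0// ltW.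
have P0 : (0 < #|P|)%N by rewrite -(ltr0n R).
have Q0 : (0 < #|Q|)%N by rewrite -(ltr0n R).
have enrho : energy R (mem P) (mem Q) (fun p q => p * q)%g <=
    kappa / (theta * k%:R) * #|P|%:R ^+ 2 * #|Q|%:R ^+ 2.
  apply: le_trans enPQ _.
  rewrite [leRHS](_ : _ = kappa * #|P|%:R ^+ 2 * #|Q|%:R *
    (#|Q|%:R / (theta * k%:R))); last by field; rewrite !gt_eqF.
  by rewrite ler_peMr ?mulr_ge0// ler_pdivlMr// mul1r.
have dense : theta * (#|P|%:R * #|Q|%:R) <=
    \sum_(p in P) \sum_(q in Q) h (p * q)%g.
  by apply: le_trans hPQ; rewrite ler_pM2l// expr2; apply: ler_pM.
have cube (a : R) : theta * k%:R <= a -> s%:R ^+ 3 / a <= s%:R ^+ 2.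
  move=> ha; rewrite ler_pdivrMr ?(lt_le_trans thk)// exprSr.
  by rewrite ler_pM2l ?exprn_gt0// (le_trans sk).
have sumle : s%:R ^+ 2 + s%:R ^+ 3 / #|Q|%:R + s%:R ^+ 3 / #|P|%:R +
    s%:R ^+ 4 * (kappa / (theta * k%:R)) <=
    3 * s%:R ^+ 2 + s%:R ^+ 4 * (kappa / (theta * k%:R)).
  have := cube _ tP; have := cube _ tQ.
  move: (_ / #|P|%:R) (_ / #|Q|%:R) => u v; lra.
have [x [y [xP yQ hF hE]]] :=
  exists_low_energy_samples P0 Q0 rho0 enrho s0 theta0 h1 dense sumle.
exists x, y; split => //.
- by move/ffun_onP: xP.
- by move/ffun_onP: yQ.
Qed.

Hypothesis hG : exponent [set: G]%G = 2%N.

(** The pairs split into three blocks, one of which carries a third of the sum. The blocks with a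
    peeled set [X1] or [Y1] have small energy; in the third, samples of both residual sets lie in a
    span of at most [2 * m] elements. *)
Lemma structured_samples (X Y : {set G}) (m e : nat) :
  (0 < m)%N -> #|X| = k -> #|Y| = k -> (m.+1 * k < 2 ^ e)%N ->
  (8 * e)%:R * s%:R ^+ 2 <= m%:R * (theta * k%:R) ->
  3 * theta * k%:R ^+ 2 <= \sum_(x in X) \sum_(y in Y) h (x * y)%g ->
  exists xy : {ffun 'I_s -> G} * {ffun 'I_s -> G},
    theta / 2 * s%:R ^+ 2 <=
      \sum_(i < s) \sum_(j < s) h (xy.1 i * xy.2 j)%g /\
    (energy R predT predT (fun i j : 'I_s => xy.1 i * xy.2 j)%g
      <= 8 / theta * s%:R ^+ 2 \/
     xy \in spanned G s (2 * m) /\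
     energy R predT predT (fun i j : 'I_s => xy.1 i * xy.2 j)%g
      <= 2 / theta * (3 * s%:R ^+ 2 + s%:R ^+ 4 * (1 / (theta * k%:R)))).
Proof.
move=> m0 Xk Yk he hes hXY.
have mR : 0 < m%:R :> R by rewrite ltr0n.
have kR : 0 < k%:R :> R by rewrite ltr0n.
have thk : 0 < theta * k%:R by rewrite mulr_gt0.
have [X1 sX1 [enX1 [L1 L1m sL1]]] := decomposition R hG X m0.
have [Y1 sY1 [enY1 [L2 L2m sL2]]] := decomposition R hG Y m0.
have cle (A B : {set G}) : A \subset B -> #|B| = k -> (#|A| <= k)%N.
  by move=> sAB <-; exact: subset_leq_card.
have cX1 := cle _ _ sX1 Xk; have cY1 := cle _ _ sY1 Yk.
have cX2 := cle _ _ (subsetDl X X1) Xk; have cY2 := cle _ _ (subsetDl Y Y1) Yk.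
have low (P Q : {set G}) : (#|P| <= k)%N -> (#|Q| <= k)%N ->
    theta * k%:R ^+ 2 <= \sum_(p in P) \sum_(q in Q) h (p * q)%g ->
    energy R (mem P) (mem Q) (fun p q => p * q)%g
      <= (8 * e)%:R / m%:R * #|P|%:R ^+ 2 * #|Q|%:R ->
    exists xy : {ffun 'I_s -> G} * {ffun 'I_s -> G},
      theta / 2 * s%:R ^+ 2 <=
        \sum_(i < s) \sum_(j < s) h (xy.1 i * xy.2 j)%g /\
      energy R predT predT (fun i j : 'I_s => xy.1 i * xy.2 j)%g
        <= 8 / theta * s%:R ^+ 2.
  move=> Pk Qk hPQ enPQ.
  have [|x [y [_ _ hF hE]]] := dense_part_samples _ Pk Qk hPQ enPQ.
    by rewrite divr_ge0.
  exists (x, y); split => //; apply: le_trans hE _.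
  (* The hypothesis on [e] reduces the quartic term to [s ^ 2], so [3 + 1] gives the constant 8. *)
  rewrite [leRHS](_ : _ = 2 / theta * (3 * s%:R ^+ 2 + s%:R ^+ 2)); last first.
    by field; rewrite gt_eqF.
  rewrite ler_pM2l ?divr_gt0// lerD2l.
  rewrite [leLHS](_ : _ = s%:R ^+ 2 *
    ((8 * e)%:R * s%:R ^+ 2 / (m%:R * (theta * k%:R)))); last first.
    by field; rewrite !gt_eqF.
  by rewrite ler_piMr ?sqr_ge0// ler_pdivrMr ?mulr_gt0// mul1r.
have split3 : \sum_(x in X) \sum_(y in Y) h (x * y)%g =
    \sum_(x in X1) \sum_(y in Y) h (x * y)%g +
    (\sum_(y in Y1) \sum_(x in X :\: X1) h (y * x)%g +
     \sum_(x in X :\: X1) \sum_(y in Y :\: Y1) h (x * y)%g).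
  rewrite (big_setID X1)/= (setIidPr sX1); congr (_ + _).
  rewrite [X in _ = X + _](_ : _ =
    \sum_(x in X :\: X1) \sum_(y in Y1) h (x * y)%g); last first.
    rewrite exchange_big/=; apply: eq_bigr => x _; apply: eq_bigr => y _.
    by rewrite exponent2_mulgC.
  rewrite -big_split/=; apply: eq_bigr => x _.
  by rewrite (big_setID Y1)/= (setIidPr sY1).
have [hA|hA] := leP (theta * k%:R ^+ 2) (\sum_(x in X1) \sum_(y in Y) h (x * y)%g).
  have heY : (m.+1 * #|Y| < 2 ^ e)%N by rewrite Yk.
  have [xy [? ?]] := low X1 Y cX1 (eq_leq Yk) hA (enX1 Y e heY).
  by exists xy; split => //; left.
have [hB|hB] := leP (theta * k%:R ^+ 2)
    (\sum_(y in Y1) \sum_(x in X :\: X1) h (y * x)%g).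
  have heX : (m.+1 * #|X :\: X1| < 2 ^ e)%N.
    by apply: leq_ltn_trans he; rewrite leq_mul2l cX2 orbT.
  have [xy [? ?]] := low Y1 (X :\: X1) cY1 cX2 hB (enY1 _ e heX).
  by exists xy; split => //; left.
(* The residual sets have only the trivial energy bound, whence [kappa = 1]. *)
have [|||||x [y [xX yY hF hE]]] := @dense_part_samples (X :\: X1) (Y :\: Y1) 1.
- by [].
- exact: cX2.
- exact: cY2.
- by move: hXY hA hB; rewrite split3; lra.
- by rewrite mul1r; exact: energy_le_trivial.
exists (x, y); split => //; right; split => //.
rewrite inE; apply/existsP.
(* The default value of [nth] pads the list of spanning elements with the identity up to length
   [2 * m]. *)
exists [ffun j : 'I_(2 * m) => nth 1%g (enum (L1 :|: L2)) j]; rewrite inE/=.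
set g := finfun _.
have Lg : L1 :|: L2 \subset g @: 'I_(2 * m).
  apply/subsetP => l lL; have il : (index l (enum (L1 :|: L2)) < 2 * m)%N.
    apply: (@leq_trans #|L1 :|: L2|); first by rewrite cardE index_mem mem_enum.
    by apply: (leq_trans (leq_card_setU _ _)); rewrite mul2n -addnn leq_add// ltnW.
  apply/imsetP; exists (Ordinal il) => //.
  by rewrite ffunE nth_index// mem_enum.
apply/forallP => i; apply/andP; split.
  apply: (subsetP (genS (fintype.subset_trans (finset.subsetUl _ _) Lg))).
  exact: (subsetP sL1).
apply: (subsetP (genS (fintype.subset_trans (finset.subsetUr _ _) Lg))).
exact: (subsetP sL2).
Qed.

End structured_samples.

(** * Counting the bad sets *)

Lemma exp2_le_expR (R : realType) (n : nat) : (2 ^ n)%N%:R <= expR n%:R :> R.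
Proof.
rewrite natrX -[n%:R in leRHS]mulr1 expRM_natl lerXn2r ?nnegrE ?expR_ge0//.
by have := expR_ge1Dx (1 : R).
Qed.

(** Shrinking first [X], then [Y], by averaging keeps the density [c], so only pairs of size exactly
    [k] need be treated. *)
Lemma exists_square_bounds (R : realType) (G : finGroupType) (h : G -> R)
    (X Y : {set G}) (c : R) (k : nat) :
  (0 < k)%N -> (k <= #|X|)%N -> (k <= #|Y|)%N ->
  c * (#|X|%:R * #|Y|%:R) <= \sum_(x in X) \sum_(y in Y) h (x * y)%g ->
  exists X' Y' : {set G}, [/\ #|X'| = k, #|Y'| = k &
    c * k%:R ^+ 2 <= \sum_(x in X') \sum_(y in Y') h (x * y)%g].
Proof.
move=> k0 kX kY hXY.
have [X' _ [cX' hX']] :=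
  subset_mean (fun x => \sum_(y in Y) h (x * y)%g) k0 kX.
have [Y' _ [cY' hY']] :=
  subset_mean (fun y => \sum_(x in X') h (x * y)%g) k0 kY.
exists X', Y'; split=> //.
have X0 : 0 < #|X|%:R :> R by rewrite ltr0n (leq_trans k0).
have Y0 : 0 < #|Y|%:R :> R by rewrite ltr0n (leq_trans k0).
have kR : 0 < k%:R :> R by rewrite ltr0n.
move: hY'; rewrite exchange_big [in X in _ <= X]exchange_big/= => hY'.
rewrite -(ler_pM2l (mulr_gt0 X0 Y0)).
apply: (@le_trans _ _ (k%:R ^+ 2 * \sum_(x in X) \sum_(y in Y) h (x * y)%g)).
  rewrite [leLHS](_ : _ = k%:R ^+ 2 * (c * (#|X|%:R * #|Y|%:R))); last by ring.
  by rewrite ler_pM2l ?exprn_gt0.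
rewrite expr2 -mulrA; apply: le_trans (ler_wpM2l (ltW kR) hX') _.
by rewrite mulrCA -mulrA; apply: ler_wpM2l.
Qed.

Section few_bad_sets.
Variables (R : realType) (G : finGroupType) (theta : R) (d r u U : nat).
Hypothesis hG : exponent [set: G]%G = 2%N.
Hypothesis cG : #|G| = (2 ^ d)%N.
Hypotheses (theta0 : 0 < theta) (d0 : (0 < d)%N).
Hypotheses (rd : (r ^ 2 <= d)%N) (dr : (d < r.+1 ^ 2)%N).
Hypotheses (u0 : (0 < u)%N) (hu : 7 * 2 ^+ 8 <= theta ^+ 3 * u%:R).
Hypotheses (hU : 120 * u%:R ^+ 2 <= theta * U%:R) (Ud : (U <= d)%N).

(** With [r] the integer square root of [d] and [t] just above its binary logarithm, [k] is of order
    [d ^ (3 / 2) * log d] for fixed [U]. [E1] and [E2] are the two energy levels of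
    [structured_samples] for [m = r]. *)
Let t := (trunc_log 2 d).+1.
Let k := (U * d * r * t)%N.
Let s := (u * d)%N.
Let tau := theta / 2 * s%:R ^+ 2.
Let E1 := 8 / theta * s%:R ^+ 2.
Let E2 := 2 / theta * (3 * s%:R ^+ 2 + s%:R ^+ 4 * (1 / (theta * k%:R))).

Let r0 : (0 < r)%N. Proof. by case: r dr => // h; rewrite ltnNge d0 in h. Qed.

Let uR : 1 <= u%:R :> R. Proof. by rewrite ler1n. Qed.
Let dR : 1 <= d%:R :> R. Proof. by rewrite ler1n. Qed.
Let rR : 1 <= r%:R :> R. Proof. by rewrite ler1n. Qed.
Let tR : 1 <= t%:R :> R. Proof. by rewrite ler1n. Qed.

Let U0 : (0 < U)%N.
Proof.
rewrite -(ltr0n R) -(pmulr_rgt0 _ theta0); apply: lt_le_trans hU.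
by rewrite mulr_gt0// exprn_gt0// ltr0n.
Qed.

Let s0 : (0 < s)%N. Proof. by rewrite muln_gt0 u0. Qed.
Let k0 : (0 < k)%N. Proof. by rewrite !muln_gt0 U0 d0 r0. Qed.

Let rdR : r%:R ^+ 2 <= d%:R :> R. Proof. by rewrite -natrX ler_nat. Qed.
Let drR : d%:R <= 3 * r%:R ^+ 2 :> R.
Proof.
rewrite -natrX -natrM ler_nat; move: dr r0; rewrite !expnS !expn0 !muln1; nia.
Qed.

Let thetak : 120 * u%:R ^+ 2 * (d%:R * r%:R * t%:R) <= theta * k%:R.
Proof.
rewrite [leRHS](_ : _ = theta * U%:R * (d%:R * r%:R * t%:R)); last first.
  by rewrite /k !natrM; ring.
by rewrite ler_pM2r// !mulr_gt0// ltr0n.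
Qed.

Let sk : s%:R <= theta * k%:R.
Proof.
apply: le_trans thetak; rewrite natrM.
apply: (@le_trans _ _ (u%:R * d%:R * (u%:R * r%:R * t%:R))).
  rewrite ler_peMr ?mulr_ge0// -[leLHS](mulr1 1) ler_pM ?mulr_ge0//.
  by rewrite -[leLHS](mulr1 1) ler_pM.
rewrite [leLHS](_ : _ = u%:R ^+ 2 * (d%:R * r%:R * t%:R)); last by ring.
rewrite ler_pM2r; last by rewrite !mulr_gt0// ltr0n.
by rewrite ler_peMl ?sqr_ge0// ler1n.
Qed.

(** The numbers [U], [d], [r], [t] and [r.+1] are all at most [2 ^ t], whence the exponent
    [5 * t]. *)
Let he : (r.+1 * k < 2 ^ (5 * t))%N.
Proof.
have dt : (d < 2 ^ t)%N by exact: trunc_log_ltn.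
have rle : (r <= d)%N by apply: leq_trans rd; rewrite expnS expn1 leq_pmulr.
have tt : (t <= 2 ^ t)%N by exact/ltnW/ltn_expl.
rewrite /k mulnC expnM (_ : 2 ^ 5 = 32)%N//.
have -> : (32 ^ t = 2 ^ t * (2 ^ t * (2 ^ t * (2 ^ t * 2 ^ t))))%N.
  by rewrite -!expnMn.
have e1 : (r * t * r.+1 <= 2 ^ t * (2 ^ t * 2 ^ t))%N.
  rewrite mulnC mulnA mulnC [(_ * (_ * _))%N]mulnC -mulnA.
  apply: leq_mul; first exact: leq_trans dt.
  by apply: leq_mul => //; apply: leq_trans (ltnW dt).
have e2 : (U * d < 2 ^ t * 2 ^ t)%N.
  by rewrite ltn_mul// (leq_ltn_trans Ud).
rewrite [X in (_ < X)%N](_ : _ =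
    2 ^ t * 2 ^ t * (2 ^ t * (2 ^ t * 2 ^ t)))%N; last by ring.
rewrite [X in (X < _)%N](_ : _ = U * d * (r * t * r.+1))%N; last by ring.
apply: (@leq_ltn_trans (U * d * (2 ^ t * (2 ^ t * 2 ^ t)))%N).
  by rewrite leq_mul2l e1 orbT.
by rewrite ltn_mul2r e2 !muln_gt0 expn_gt0.
Qed.

(** The 120 in the choice of [U] is [3 * 40]: the 3 is lost in [d <= 3 * r ^ 2], and [40 = 8 * 5]
    comes from [hes] with exponent [5 * t]. *)
Let r2thetak : 40 * u%:R ^+ 2 * d%:R ^+ 2 * t%:R <= r%:R * (theta * k%:R).
Proof.
apply: (@le_trans _ _
    (r%:R * (120 * u%:R ^+ 2 * (d%:R * r%:R * t%:R)))); last first.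
  by rewrite ler_wpM2l.
rewrite [leRHS](_ : _ = 40 * u%:R ^+ 2 * d%:R * (3 * r%:R ^+ 2) * t%:R);
  last by ring.
rewrite [leLHS](_ : _ = 40 * u%:R ^+ 2 * d%:R * d%:R * t%:R); last by ring.
by rewrite ler_wpM2r// ler_wpM2l// !mulr_ge0// sqr_ge0.
Qed.

Let hes : (8 * (5 * t))%:R * s%:R ^+ 2 <= r%:R * (theta * k%:R).
Proof.
apply: le_trans r2thetak; rewrite /s !natrM exprMn -subr_ge0.
by rewrite [X in 0 <= X](_ : _ = 0)//; ring.
Qed.

(** The spanned case costs a factor [r] in energy over [E1]; the smaller number of spanned samples
    makes up for it. *)
Let E2_le : E2 <= 8 * r%:R / theta * s%:R ^+ 2.
Proof.
have thk0 : 0 < theta * k%:R by rewrite mulr_gt0// ltr0n.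
rewrite [leRHS](_ : _ = 2 / theta * (4 * r%:R * s%:R ^+ 2)); last by field; rewrite gt_eqF.
rewrite /E2 ler_pM2l ?divr_gt0//.
have h : s%:R ^+ 2 / (theta * k%:R) <= r%:R.
  rewrite ler_pdivrMr//; apply: le_trans r2thetak.
  rewrite natrM exprMn -[leLHS]mulr1 ler_pM ?mulr_ge0 ?sqr_ge0//.
  by rewrite -mulrA ler_peMl ?mulr_ge0 ?sqr_ge0// ler1n.
have -> : s%:R ^+ 4 * (1 / (theta * k%:R)) =
  s%:R ^+ 2 * (s%:R ^+ 2 / (theta * k%:R)) by rewrite mul1r mulrA -exprD.
have := ler_wpM2l (sqr_ge0 (s%:R : R)) h.
have := ler_wpM2l (sqr_ge0 (s%:R : R)) rR.
move: (s%:R ^+ 2 / _) => v; lra.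
Qed.

Let E10 : 0 < E1. Proof. by rewrite mulr_gt0 ?divr_gt0 ?exprn_gt0 ?ltr0n. Qed.
Let E20 : 0 < E2.
Proof.
rewrite mulr_gt0 ?divr_gt0// ltr_pwDl ?mulr_gt0 ?exprn_gt0 ?ltr0n//.
by rewrite mulr_ge0 ?exprn_ge0// divr_ge0// mulr_ge0// ltW.
Qed.
Let tau0 : 0 < tau. Proof. by rewrite mulr_gt0 ?divr_gt0 ?exprn_gt0 ?ltr0n. Qed.

(** The right-hand side is [tau ^+ 2 / (8 * E1)]. The 7 is [2 + 4 + 1], from the terms [2 * d * r],
    [4 * r * s] and [d] to be beaten in [count_spanned] after multiplication by [r]. *)
Let theta3u : 7 * u%:R * d%:R ^+ 2 <= theta ^+ 3 * s%:R ^+ 2 / 2 ^+ 8.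
Proof.
rewrite natrM exprMn.
rewrite [leRHS](_ : _ = theta ^+ 3 * u%:R / 2 ^+ 8 * (u%:R * d%:R ^+ 2)); last by field.
rewrite -mulrA ler_wpM2r ?mulr_ge0 ?sqr_ge0// ler_pdivlMr//.
Qed.

Let count_all : (#|[set: {ffun 'I_s -> G} * {ffun 'I_s -> G}]|%:R : R)
  * expR (- (tau ^+ 2 / (8 * E1))) <= expR (- d%:R).
Proof.
rewrite cardsT card_prod card_ffun card_ord cG -expnM -expnD.
apply: le_trans (ler_wpM2r (expR_ge0 _) (exp2_le_expR _ _)) _.
rewrite -expRD ler_expR /tau /E1.
have -> : (theta / 2 * s%:R ^+ 2) ^+ 2 / (8 * (8 / theta * s%:R ^+ 2)) =
    theta ^+ 3 * s%:R ^+ 2 / 2 ^+ 8.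
  by field; rewrite gt_eqF// pnatr_eq0 -lt0n s0.
have h : 2 * (d%:R * (u%:R * d%:R)) + d%:R <= 7 * u%:R * d%:R ^+ 2 :> R.
  have : 1 * d%:R <= u%:R * d%:R :> R by rewrite ler_wpM2r.
  have : u%:R * d%:R * 1 <= u%:R * d%:R * d%:R :> R by rewrite ler_wpM2l// mulr_ge0.
  by have := dR; rewrite expr2; lra.
move: theta3u; rewrite natrD natrM natrM; lra.
Qed.

Let count_spanned : (#|spanned G s (2 * r)|%:R : R)
  * expR (- (tau ^+ 2 / (8 * E2))) <= expR (- d%:R).
Proof.
have hE : theta ^+ 3 * s%:R ^+ 2 / 2 ^+ 8 / r%:R <= tau ^+ 2 / (8 * E2).
  rewrite ler_pdivlMr; last by rewrite pmulr_rgt0 ?E20.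
  apply: (@le_trans _ _ (theta ^+ 3 * s%:R ^+ 2 / 2 ^+ 8 / r%:R *
      (8 * (8 * r%:R / theta * s%:R ^+ 2)))).
    rewrite ler_wpM2l//; last by rewrite ler_pM2l.
    by rewrite !mulr_ge0 ?invr_ge0 ?exprn_ge0// ltW.
  rewrite -subr_ge0 /tau [X in 0 <= X](_ : _ = 0)//.
  by field; rewrite !gt_eqF// ltr0n.
have : (#|spanned G s (2 * r)| <= 2 ^ (d * (2 * r) + 2 * (2 * r) * s))%N.
  by apply: leq_trans (card_spanned s hG _) _; rewrite cG -expnM -expnD.
rewrite -(ler_nat R) => /le_trans/(_ (exp2_le_expR _ _)) h.
have e0 : 0 <= expR (- (tau ^+ 2 / (8 * E2))) by exact: expR_ge0.
apply: le_trans (ler_wpM2r e0 h) _.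
rewrite -expRD ler_expR; apply: (@le_trans _ _ ((d * (2 * r) + 2 * (2 * r) * s)%:R -
  theta ^+ 3 * s%:R ^+ 2 / 2 ^+ 8 / r%:R)); first by rewrite lerD2l lerN2.
rewrite lerBlDl -lerBlDr opprK ler_pdivlMr ?ltr0n//; apply: le_trans theta3u.
have e1 : r%:R ^+ 2 * d%:R <= d%:R * d%:R :> R by rewrite ler_wpM2r.
have e2 : u%:R * (r%:R ^+ 2 * d%:R) <= u%:R * (d%:R * d%:R) :> R by rewrite ler_wpM2l.
have e3 : d%:R * r%:R <= d%:R * d%:R :> R.
  rewrite ler_wpM2l//; apply: le_trans rdR; rewrite expr2 ler_peMr//.
have e4 : 1 * (d%:R * d%:R) <= u%:R * (d%:R * d%:R) :> R.
  by rewrite ler_wpM2r// mulr_ge0.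
rewrite natrD !natrM expr2 in e1 e2 *; lra.
Qed.

(** A bad set falls into one of four families, given by the sign of the deviation and the energy
    level of the samples; each contributes at most [expR (- d) * 2 ^ #|G|]. *)
Lemma few_bad_sets :
  #|[set A : {set G} | [exists X : {set G}, [exists Y : {set G},
     [&& (k <= #|X|)%N, (k <= #|Y|)%N & 3 * theta * (#|X|%:R * #|Y|%:R) <
       `|\sum_(x in X) \sum_(y in Y) signed_char R A (x * y)%g|]]]]|%:R
  <= 4 * expR (- d%:R) * 2 ^+ #|G| :> R.
Proof.
pose B (D : {set {ffun 'I_s -> G} * {ffun 'I_s -> G}}) (E c : R) :=
  [set A : {set G} | [exists xy : {ffun 'I_s -> G} * {ffun 'I_s -> G} in D,
   (energy R predT predT (fun i j : 'I_s => xy.1 i * xy.2 j)%g <= E) &&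
   (tau <= \sum_(i < s) \sum_(j < s) c * signed_char R A (xy.1 i * xy.2 j)%g)]].
pose B1 := B setT E1; pose B2 := B (spanned G s (2 * r)) E2.
have cB1 (c : R) : c ^+ 2 = 1 -> #|B1 c|%:R <= expR (- d%:R) * 2 ^+ #|G| :> R.
  move=> c2; apply: le_trans (deviation_union _ c2 E10 tau0) _.
  by rewrite mulrCA mulrC ler_pM2r ?exprn_gt0.
have cB2 (c : R) : c ^+ 2 = 1 -> #|B2 c|%:R <= expR (- d%:R) * 2 ^+ #|G| :> R.
  move=> c2; apply: le_trans (deviation_union _ c2 E20 tau0) _.
  by rewrite mulrCA mulrC ler_pM2r ?exprn_gt0.
set bad := [set A | _].
have sub : bad \subset (B1 1 :|: B2 1) :|: (B1 (- 1) :|: B2 (- 1)).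
  apply/subsetP => A; rewrite inE => /existsP[X /existsP[Y /and3P[kX kY hXY]]].
  have [c [c1 hc]] : exists c : R, (c = 1 \/ c = - 1) /\
      3 * theta * (#|X|%:R * #|Y|%:R) <=
      \sum_(x in X) \sum_(y in Y) c * signed_char R A (x * y)%g.
    move: hXY; have [S0|S0] := ler0P (\sum_(x in X) \sum_(y in Y) signed_char R A (x * y)%g).
      move=> hXY; exists (- 1); split; first by right.
      by under eq_bigr do rewrite -mulr_sumr; rewrite -mulr_sumr mulN1r ltW.
    move=> hXY; exists 1; split; first by left.
    by under eq_bigr do rewrite -mulr_sumr; rewrite -mulr_sumr mul1r ltW.
  have pm1 g : c * signed_char R A g <= 1.
    by rewrite /signed_char; case: c1 => ->; case: ifP => _; lra.
  have [X' [Y' [cX' cY' hX'Y']]] := 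
    @exists_square_bounds R G (fun g => c * signed_char R A g) X Y _ k k0 kX kY hc.
  have [xy [hF hE]] :=
    @structured_samples R G (fun g => c * signed_char R A g) theta k s pm1 theta0 k0 s0 sk hG X' Y' r (5 * t)
      r0 cX' cY' he hes hX'Y'.
  have : A \in B1 c :|: B2 c.
    rewrite !inE; apply/orP; case: hE => [hE|[sp hE]]; [left|right].
      by apply/existsP; exists xy; rewrite finset.in_setT hE.
    by apply/existsP; exists xy; rewrite sp hE.
  by rewrite [in X in _ -> X]inE; case: c1 => -> ->; rewrite ?orbT.
have := subset_leq_card sub; rewrite -(ler_nat R) => /le_trans; apply.
have cU (V W : {set {set G}}) : #|V :|: W|%:R <= #|V|%:R + #|W|%:R :> R.
  by rewrite -natrD ler_nat leq_card_setU.
have n2 : (- 1) ^+ 2 = 1 :> R by rewrite sqrrN expr1n.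
have n1 : 1 ^+ 2 = 1 :> R by rewrite expr1n.
set x := expR _ * _ in cB1 cB2.
rewrite -mulrA -/x (_ : 4 * x = (x + x) + (x + x)); last by ring.
apply: le_trans (cU _ _) _; apply: lerD; apply: le_trans (cU _ _) _.
  by apply: lerD; [exact: cB1|exact: cB2].
by apply: lerD; [exact: cB1|exact: cB2].
Qed.

End few_bad_sets.

(** * Comparison with the size threshold *)

Lemma ln2_ge (R : realType) : 1 / 2 <= ln 2 :> R.
Proof.
have : ln (1 + (- (1 / 2))) <= - (1 / 2) :> R by apply: le_ln1Dx; lra.
by rewrite (_ : 1 - 1 / 2 = 2^-1); [rewrite lnV ?posrE//; lra|field].
Qed.

(** With [v] the logarithm of the group order, [d * r <= 4 * v ^ (3 / 2)] and the binary logarithm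
    factor is at most [5 * ln v], so 20 is [4 * 5]. The bound [8 <= d] ensures [ln v >= 1]. *)
Lemma size_threshold_ge (R : realType) (w : nat -> R) (U d r : nat) :
  (8 <= d)%N -> (r ^ 2 <= d)%N -> 20 * U%:R <= w (2 ^ d)%N ->
  (U * d * r * (trunc_log 2 d).+1)%N%:R <= size_threshold w (2 ^ d).
Proof.
move=> d8 rd hw; rewrite /size_threshold natrX lnXn//.
have l2 := ln2_ge R.
have l2' : ln 2 <= 1 :> R by have := @le_ln1Dx R 1; rewrite (_ : 1 + 1 = 2)//; apply; lra.
have d8R : 8 <= d%:R :> R by rewrite ler_nat.
rewrite -[ln 2 *+ d]mulr_natl; set v : R := d%:R * ln 2.
have dv : d%:R <= 2 * v by rewrite /v; nra.
have v4 : 4 <= v by lra.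
have lnv : 1 <= ln v.
  apply: (@le_trans _ _ (ln 4)); last by rewrite ler_ln ?posrE//; lra.
  by rewrite (_ : 4 = 2 * 2); [rewrite lnM ?posrE//; lra|ring].
have lnd : ln d%:R <= 1 + ln v.
  apply: (@le_trans _ _ (ln (2 * v))); first by rewrite ler_ln ?posrE//; lra.
  by rewrite lnM ?posrE//; lra.
have tlog : (trunc_log 2 d)%:R * ln 2 <= ln d%:R :> R.
  rewrite mulr_natl -lnXn// ler_ln ?posrE ?exprn_gt0 ?ltr0n//; last exact: leq_trans d8.
  by rewrite -natrX ler_nat trunc_logP// (leq_trans _ d8).
have tv : (trunc_log 2 d).+1%:R <= 5 * ln v :> R.
  rewrite -natr1; have : 0 <= (trunc_log 2 d)%:R :> R by [].
  by move: (trunc_log 2 d)%:R tlog => T hT T0; nra.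
have -> : v `^ (3 / 2) = v * Num.sqrt v.
  rewrite (_ : 3 / 2 = 1 + 2^-1); last by field.
  rewrite powRD; last by apply/implyP => _; rewrite gt_eqF//; lra.
  by rewrite powRr1 ?powR12_sqrt//; lra.
have rs : r%:R <= 2 * Num.sqrt v.
  rewrite -(@ler_pXn2r _ 2)// ?nnegrE ?mulr_ge0 ?sqrtr_ge0//.
  rewrite exprMn sqr_sqrtr; last lra.
  have : r%:R ^+ 2 <= d%:R :> R by rewrite -natrX ler_nat.
  lra.
have dr : d%:R * r%:R <= 4 * (v * Num.sqrt v).
  apply: (@le_trans _ _ ((2 * v) * (2 * Num.sqrt v))); first exact: ler_pM.
  by rewrite -subr_ge0 [X in 0 <= X](_ : _ = 0)//; ring.
have drt : d%:R * r%:R * (trunc_log 2 d).+1%:R <=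
    4 * (v * Num.sqrt v) * (5 * ln v).
  by apply: ler_pM => //; rewrite mulr_ge0.
rewrite -!mulnA natrM mulnA natrM natrM.
apply: (@le_trans _ _ (U%:R * (4 * (v * Num.sqrt v) * (5 * ln v)))).
  exact: ler_wpM2l.
rewrite [leLHS](_ : _ = 20 * U%:R * (ln v * (v * Num.sqrt v))); last by ring.
rewrite -[leRHS]mulrA ler_wpM2r// !mulr_ge0 ?sqrtr_ge0//; lra.
Qed.

Lemma exists_sqrt_floor (d : nat) : exists2 r, (r ^ 2 <= d)%N & (d < r.+1 ^ 2)%N.
Proof.
elim: d => [|d [r rd dr]]; first by exists 0%N.
have [h|h] := ltnP d.+1 (r.+1 ^ 2); first by exists r => //; exact: leqW.
exists r.+1 => //; move: dr; rewrite !expnS !expn0 !muln1; nia.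
Qed.

(** * From counting to probability *)

Section half_random_subset.
Variables (R : realType) (T : finType).

Lemma random_subset_mass_half (S : {set T}) :
  random_subset_mass (1 / 2 : R) S = (2 ^+ #|T|)^-1.
Proof.
rewrite /random_subset_mass (eq_bigr (fun=> 2^-1)).
  by rewrite prodr_const exprVn.
by move=> x _; case: ifP => _; field.
Qed.

Lemma random_subset_prob_half_ge0 (E : {set T} -> Prop) :
  0 <= random_subset_prob (1 / 2 : R) E.
Proof.
apply: sumr_ge0 => S _; rewrite random_subset_mass_half.
by rewrite invr_ge0 exprn_ge0.
Qed.

Lemma random_subset_prob_half_ge (E : {set T} -> Prop) (B : {set {set T}}) :
  (forall S, S \notin B -> E S) ->
  1 - #|B|%:R / 2 ^+ #|T| <= random_subset_prob (1 / 2 : R) E.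
Proof.
move=> BE; have pT : 0 < 2 ^+ #|T| :> R by rewrite exprn_gt0.
have -> : 1 - #|B|%:R / 2 ^+ #|T| =
    \sum_(S in ~: B) random_subset_mass (1 / 2 : R) S.
  under eq_bigr do rewrite random_subset_mass_half.
  rewrite sumr_const -[_ *+ _]mulr_natl.
  have cBC : #|B|%:R + #|~: B|%:R = 2 ^+ #|T| :> R.
    by rewrite -natrD cardsC -natrX -cardsT -powersetT card_powerset cardsT.
  by rewrite -cBC; field; rewrite cBC gt_eqF.
rewrite /random_subset_prob [leRHS](bigID (fun S => S \in ~: B))/=.
rewrite [X in _ <= X + _](eq_bigl (fun S => S \in ~: B)); last first.
  move=> S; rewrite inE; case: (boolP (S \in B)) => SB; rewrite ?andbF//.
  by rewrite andbT; apply/asboolP; exact: BE.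
rewrite lerDl; apply: sumr_ge0 => S _; rewrite random_subset_mass_half.
by rewrite invr_ge0 ltW.
Qed.

End half_random_subset.

Definition discrepancy_le (R : realType) (w : nat -> R) (eps : R)
    (G : finGroupType) (A : {set G}) : Prop :=
  forall X Y : {set G},
    size_threshold w #|G| <= #|X|%:R -> size_threshold w #|G| <= #|Y|%:R ->
    `| \sum_(x in X) \sum_(y in Y) char_fun R A (x * y)%g
       - 1 / 2 * (#|X|%:R * #|Y|%:R) | <= eps * (#|X|%:R * #|Y|%:R).

(** Pointwise, the indicator minus one half is half a sign. *)
Lemma sum_char_fun_centered (R : realType) (G : finGroupType) (A X Y : {set G}) :
  \sum_(x in X) \sum_(y in Y) char_fun R A (x * y)%g
    - 1 / 2 * (#|X|%:R * #|Y|%:R) =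
  1 / 2 * \sum_(x in X) \sum_(y in Y) signed_char R A (x * y)%g.
Proof.
have -> : #|X|%:R * #|Y|%:R = \sum_(x in X) \sum_(y in Y) (1 : R).
  by rewrite !sumr_const -mulrnA natrM mulrC.
rewrite !mulr_sumr -sumrB; apply: eq_bigr => x _.
rewrite !mulr_sumr -sumrB; apply: eq_bigr => y _.
by rewrite /char_fun /signed_char; case: ifP => _ /=; field.
Qed.

(** One number [eta] bounds both the failure probability and the relative error, and [n0] is uniform
    over all groups of a given order. *)
Lemma discrepancy_whp (R : realType) (w : nat -> R) (eta : R) :
  (w n @[n --> \oo] --> +oo)%classic -> 0 < eta ->
  exists n0, forall n, (n0 <= n)%N -> forall G : finGroupType,
    exponent [set: G]%G = 2%N -> #|G| = n ->
    1 - eta <= random_subset_prob (1 / 2 : R) (@discrepancy_le R w eta G).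
Proof.
(* Chosen so that half of [3 * theta] equals [eta]. *)
move=> winf eta0; pose theta : R := 2 / 3 * eta.
have th0 : 0 < theta by rewrite mulr_gt0.
have leb (x : R) : 0 <= x -> x <= (Num.bound x)%:R by move/archi_boundP/ltW.
pose u := (Num.bound (7 * 2 ^+ 8 / theta ^+ 3)).+1.
pose U := Num.bound (120 * u%:R ^+ 2 / theta).
have hu : 7 * 2 ^+ 8 <= theta ^+ 3 * u%:R.
  rewrite -ler_pdivrMl ?exprn_gt0// mulrC.
  apply: (@le_trans _ _ (Num.bound (7 * 2 ^+ 8 / theta ^+ 3))%:R).
    by rewrite leb// !mulr_ge0 ?invr_ge0 ?exprn_ge0// ltW.
  by rewrite ler_nat.
have hU : 120 * u%:R ^+ 2 <= theta * U%:R.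
  by rewrite -ler_pdivrMl// mulrC leb// divr_ge0 ?mulr_ge0 ?sqr_ge0// ltW.
move/cvgryPge: winf => /(_ (20 * U%:R)) [n1 _ hn1].
(* For [d >= b] one gets [4 * expR (- d) <= eta], because [d <= expR d]. *)
pose b := Num.bound (4 / eta).
exists (maxn n1 (2 ^ (maxn U (maxn 8 b)))) => n; rewrite geq_max => /andP[n1n].
move=> Dn G hG cG.
have ab : (2.-abelem [set: G])%g by rewrite exponent2_abelem// hG.
have cGd : #|G| = (2 ^ logn 2 #|[set: G]|)%N.
  by rewrite -cardsT; exact: card_pgroup (abelem_pgroup ab).
move: cGd; move: (logn _ _) => d cGd.
move: Dn; rewrite -cG cGd leq_exp2l// !geq_max => /and3P[Ud d8 bd].
have [r rd dr] := exists_sqrt_floor d.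
have wU : 20 * U%:R <= w (2 ^ d)%N by rewrite -cGd cG; exact: hn1.
have kthr := size_threshold_ge d8 rd wU.
have d0 : (0 < d)%N by exact: leq_trans d8.
have few := @few_bad_sets R G theta d r u U hG cGd th0 d0 rd dr isT hu hU Ud.
set B := [set A | _] in few.
apply: (@le_trans _ _ (1 - #|B|%:R / 2 ^+ #|G|)).
  rewrite lerD2l lerN2 ler_pdivrMr ?exprn_gt0//; apply: le_trans few _.
  rewrite ler_wpM2r ?exprn_ge0// expRN ler_pdivrMr ?expR_gt0//.
  rewrite mulrC -ler_pdivrMr//; apply: (@le_trans _ _ d%:R); last first.
    by apply: le_trans (expR_ge1Dx _); rewrite lerDr.
  by apply: (@le_trans _ _ b%:R); [apply: leb; rewrite divr_ge0// ltW|rewrite ler_nat].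
apply: random_subset_prob_half_ge => A; rewrite inE => nA X Y.
rewrite cGd => hX hY; rewrite sum_char_fun_centered normrM ger0_norm ?divr_ge0//.
have kX := le_trans kthr hX; have kY := le_trans kthr hY.
rewrite !ler_nat in kX kY.
rewrite leNgt; apply/negP => bad; move/negP: nA; apply.
apply/existsP; exists X; apply/existsP; exists Y; rewrite kX kY/=.
by move: bad; rewrite /theta; lra.
Qed.

(** * Diagonal choice of the rates *)

(** Take for [J n] the largest [j <= n] with [Q j n]. The cap by [n] makes the maximum finite, and
    [J n >= j] as soon as [n] exceeds both [j] and the threshold for [j]. *)
Lemma diagonal_sequence (Q : nat -> nat -> Prop) :
  (forall n, Q 0%N n) ->
  (forall j, exists n0, forall n, (n0 <= n)%N -> Q j n) ->
  exists2 J : nat -> nat, (J n @[n --> \oo] --> \oo)%classic & forall n, Q (J n) n.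
Proof.
move=> Q0 Qlarge.
exists (fun n => \max_(j < n.+1 | `[< Q j n >]) j)%N.
  apply/cvgnyPge => j; have [n0 hn0] := Qlarge j.
  exists (maxn n0 j) => // n /=; rewrite geq_max => /andP[n0n jn].
  have jn' : (j < n.+1)%N by [].
  apply: (@leq_bigmax_cond _ (fun i : 'I_n.+1 => `[< Q i n >])
    (fun i : 'I_n.+1 => i : nat) (Ordinal jn')).
  by apply/asboolP; exact: hn0.
(* A maximum is one of its terms, or the default 0, which [Q0] covers. *)
move=> n; apply: (big_ind (fun j => Q j n)) => [//|i j Qi Qj|i /asboolP//].
by rewrite /maxn; case: ifP.
Qed.

Local Open Scope classical_set_scope.

Theorem theorem7 (R : realType) (w : nat -> R)
    (w_growing : {homo w : m n / (m <= n)%N >-> m <= n})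
    (w_infty : w n @[n --> \oo] --> +oo) :
  exists delta : nat -> R, exists eps : nat -> R,
    [/\ delta n @[n --> \oo] --> (0 : R),
        eps n @[n --> \oo] --> (0 : R) &
        forall G : finGroupType, exponent [set: G]%G = 2%N ->
          1 - delta #|G| <=
          random_subset_prob (1 / 2 : R) (fun A : {set G} =>
            forall X Y : {set G},
              size_threshold w #|G| <= #|X|%:R ->
              size_threshold w #|G| <= #|Y|%:R ->
              `| \sum_(x in X) \sum_(y in Y) char_fun R A (x * y)%g
                 - 1 / 2 * (#|X|%:R * #|Y|%:R) |
              <= eps #|G| * (#|X|%:R * #|Y|%:R))].
Proof.
pose Q (j n : nat) := forall G : finGroupType,
  exponent [set: G]%G = 2%N -> #|G| = n ->
  1 - harmonic j <=
    random_subset_prob (1 / 2 : R) (@discrepancy_le R w (harmonic j) G).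
have [n G _ _|j|J Jinf QJ] := @diagonal_sequence Q.
(* [harmonic 0] is 1, so only nonnegativity of the probability is asked. *)
- by rewrite /= invr1 subrr random_subset_prob_half_ge0.
- by apply: discrepancy_whp => //=; rewrite invr_gt0.
have lim0 : harmonic (J n) @[n --> \oo] --> (0 : R).
  exact: (cvg_comp J harmonic Jinf cvg_harmonic).
exists (harmonic \o J), (harmonic \o J); split => // G hG.
exact: QJ.
Qed.
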